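(* Let $X$ be an infinite dimensional complex Banach space and let $T\in L(X)$ be a semi-B-Fredholm operator, with $d:=\mathrm{dis}(T)$. Then there exists $(M,N)\in Red(T)$ such that $\dim N<\infty$, $\mathrm{jump}(T_M)=0$ (i.e. $\mathrm{dis}(T_M)=m_T$), and $T_N$ is nilpotent of degree $d$. Moreover $\mathrm{ind}(T)=\mathrm{ind}(T_M)$.
   Context: All definitions below apply to a bounded linear operator $T$ on an arbitrary complex Banach space $X$ (in particular to restrictions to closed invariant subspaces). $L(X)$ is the algebra of bounded linear operators on $X$; $\mathcal N(T)$, $\mathcal R(T)$ are the kernel and range, $\alpha(T)=\dim\mathcal N(T)$, $\beta(T)=\operatorname{codim}\mathcal R(T)$ (values in $\mathbb N\cup\{\infty\}$, $\mathbb N\ni 0$). For a $T$-invariant subspace $M$, $T_M$ is the restriction of $T$ to $M$. $(M,N)\in Red(T)$ means that $M,N$ are closed $T$-invariant subspaces with $X=M\oplus N$. For $n\in\mathbb N$, $T_{[n]}:=T_{\mathcal R(T^n)}:\mathcal R(T^n)\to\mathcal R(T^n)$ (so $T_{[0]}=T$). Put $a_e(T)=\inf\{n:\alpha(T_{[n]})<\infty\}$, $d_e(T)=\inf\{n:\beta(T_{[n]})<\infty\}$ and $m_T=\inf\{n:\min\{\alpha(T_{[n]}),\beta(T_{[n]})\}<\infty\}$, with $\inf\emptyset=\infty$. $T$ is upper semi-B-Fredholm if $a_e(T)<\infty$ and $\mathcal R(T^{a_e(T)+1})$ is closed; lower semi-B-Fredholm if $d_e(T)<\infty$ and $\mathcal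 R(T^{d_e(T)})$ is closed; semi-B-Fredholm if it is upper or lower semi-B-Fredholm. The index of a semi-B-Fredholm operator is $\mathrm{ind}(T)=\alpha(T_{[m_T]})-\beta(T_{[m_T]})\in\mathbb Z\cup\{\pm\infty\}$. The degree of stable iteration is $\mathrm{dis}(T)=\inf\{m\in\mathbb N:\mathcal N(T_{[m]})=\mathcal N(T_{[r]})\ \forall r\ge m\}$; it is finite for a semi-B-Fredholm operator. The reduced minimal modulus is $\gamma(T)=\inf_{x\notin\mathcal N(T)}\|Tx\|/d(x,\mathcal N(T))$ (with $\inf\emptyset=\infty$), where $d(x,\mathcal N(T))$ is the distance from $x$ to $\mathcal N(T)$. For a semi-B-Fredholm operator $T$ with $d=\mathrm{dis}(T)$ and $\epsilon=\gamma(T_{\mathcal R(T^d)})>0$, the jump of $T$ is $\mathrm{jump}(T)=\alpha(T_{[m_T]})-\alpha(T-\lambda I)$ if $T$ is upper semi-B-Fredholm, and $\mathrm{jump}(T)=\beta(T_{[m_T]})-\beta(T-\lambda I)$ if $T$ is lower semi-B-Fredholm, where $\lambda$ is an arbitrary point with $0<|\lambda|<\epsilon$ (the value does not depend on $\lambda$, and the two formulas agree when both apply). A nilpotent operator $S$ has degree $n$ if $n$ is the least element of $\mathbb N$ with $S^n=0$ (the operator on $\{0\}$ has degree $0$). *)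

(* Defs.v *)
From HB Require Import structures.
From mathcomp Require Import all_boot all_order all_algebra.
From mathcomp Require Import complex.
From mathcomp Require Import all_classical all_reals all_analysis.

Set Implicit Arguments.
Unset Strict Implicit.
Unset Printing Implicit Defensive.

Import Order.TTheory GRing.Theory Num.Theory.
Import numFieldNormedType.Exports.

Local Open Scope classical_set_scope.
Local Open Scope ring_scope.
Local Open Scope complex_scope.

(* Infimum of a set of natural numbers, with inf set0 = +oo. Elements of
   N u {oo} and Z u {+oo, -oo} are both represented in \bar int. *)
Definition natinf (P : set nat) : \bar int :=
  if `[< P !=set0 >] then
    ((xget 0%N [set n | P n /\ forall k, P k -> (n <= k)%N])%:Z)%:E
  else +oo%E.

(* The natural number n when x = n%:Z%:E; 0 when x is infinite. *)
Definition natpart (x : \bar int) : nat := absz (fine x).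

Section Defs.
Context {R : realType} {X : completeNormedModType R[i]}.

(* An operator is a pair (T, V) of a linear map T : X -> X and a T-invariant
   linear subspace V: it stands for the restriction T_V : V -> V. The operator
   T itself is (T, setT), and (T_V)_[n] is (T, rg T V n). Nothing below depends
   on the values of T outside V. *)
Implicit Types (T : X -> X) (V W M N : set X).

Definition subspace_of_X V : Prop := submod_closed [in V].

Definition norm (x : X) : R := complex.Re `|x|.

(* dim (V / W), for subspaces W of V: the size of a basis of V modulo W,
   or +oo if there is no finite one. *)
Definition qdim V W : \bar int :=
  natinf [set n | exists e : 'I_n -> X, (forall i, V (e i)) /\
    forall x, V x -> exists! c : 'rV[R[i]]_n, W (x - \sum_(i < n) c 0 i *: e i)].

Definition ldim V : \bar int := qdim V [set 0].

Definition ker T V : set X := [set x | V x /\ T x = 0].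

(* The range of (T_V)^n. *)
Definition rg T V (n : nat) : set X := iter n T @` V.

Definition alpha T V : \bar int := ldim (ker T V).

Definition beta T V : \bar int := qdim V (T @` V).

Definition Red T M N : Prop :=
  [/\ subspace_of_X M /\ subspace_of_X N,
      closed M /\ closed N,
      T @` M `<=` M /\ T @` N `<=` N,
      M `&` N = [set 0] &
      forall x, exists y z, [/\ M y, N z & x = y + z]].

Definition ess_ascent T V : \bar int :=
  natinf [set n | (alpha T (rg T V n) < +oo)%E].

Definition ess_descent T V : \bar int :=
  natinf [set n | (beta T (rg T V n) < +oo)%E].

Definition m_ T V : \bar int :=
  natinf [set n | (mine (alpha T (rg T V n)) (beta T (rg T V n)) < +oo)%E].

(* Here and below V is meant to be a closed subspace of X, so that "closed in V"
   and "closed in X" agree for the ranges. *)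
Definition upper_semi_B_Fredholm T V : Prop :=
  (ess_ascent T V < +oo)%E /\ closed (rg T V (natpart (ess_ascent T V)).+1).

Definition lower_semi_B_Fredholm T V : Prop :=
  (ess_descent T V < +oo)%E /\ closed (rg T V (natpart (ess_descent T V))).

Definition semi_B_Fredholm T V : Prop :=
  upper_semi_B_Fredholm T V \/ lower_semi_B_Fredholm T V.

(* m_ T V is finite for a semi-B-Fredholm operator, and then at most one of
   the two terms is +oo. *)
Definition ind T V : \bar int :=
  let Vm := rg T V (natpart (m_ T V)) in (alpha T Vm - beta T Vm)%E.

Definition dis T V : \bar int :=
  natinf [set m | forall r, (m <= r)%N -> ker T (rg T V m) = ker T (rg T V r)].

Definition dist (x : X) W : R := inf [set norm (x - y) | y in W].

Definition gamma T V : \bar R :=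
  ereal_inf [set (norm (T x) / dist x (ker T V))%:E
            | x in [set x | V x /\ ~ ker T V x]].

(* jump T_V = j. All admissible lambda are required to give the value j, as do
   both formulas when both apply; 0 < epsilon makes some lambda admissible. *)
Definition has_jump T V (j : \bar int) : Prop :=
  let Vm := rg T V (natpart (m_ T V)) in
  let epsilon := gamma T (rg T V (natpart (dis T V))) in
  let shift (lambda : R[i]) := fun x => T x - lambda *: x in
  [/\ semi_B_Fredholm T V,
      (0 < epsilon)%E &
      forall lambda : R[i],
        0 < `|lambda| -> ((complex.Re `|lambda|)%:E < epsilon)%E ->
        (upper_semi_B_Fredholm T V ->
           (alpha T Vm - alpha (shift lambda) V)%E = j) /\
        (lower_semi_B_Fredholm T V ->
           (beta T Vm - beta (shift lambda) V)%E = j)].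

Definition nilpotent_of_degree T V (n : nat) : Prop :=
  (forall x, V x -> iter n T x = 0) /\
  forall k, (forall x, V x -> iter k T x = 0) -> (n <= k)%N.

End Defs.

(* Main.v *)
Require Import Defs.
From HB Require Import structures.
From mathcomp Require Import all_boot all_order all_algebra.
From mathcomp Require Import complex.
From mathcomp Require Import all_classical all_reals all_analysis.
From mathcomp Require Import lra ring.
Import Order.TTheory GRing.Theory Num.Theory.
Import numFieldNormedType.Exports.
Local Open Scope classical_set_scope.
Local Open Scope ring_scope.
Local Open Scope complex_scope.
Set Implicit Arguments.
Unset Strict Implicit.
Unset Printing Implicit Defensive.

(** Write [R(T^n)] for the range of [T^n], [N_n] for [N(T)] intersected with
    [R(T^n)], and let [m] be the least index at which [N_m] or
    [R(T^m) / R(T^(m+1))] is finite dimensional.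

    From [m] on, the quotients [N_n / N_(n+1)] are finite dimensional: the first
    space is then finite dimensional, or the quotient embeds in
    [R(T^n) / R(T^(n+1))]. They vanish from [n = d], the degree of stable
    iteration, on ([kernel_stable]). Such a quotient counts the Jordan blocks of
    size [n+1] of [T]. So the kernels of [T] become stable from [m] on once the
    finitely many blocks of size [m+1, ..., d] are split off; when [d = m > 0],
    one block of size [d] is split off all the same, to reach the degree [d].

    To split off one block of size [k = p+1], take [x] with [T^p x] in [N_p] but
    not in [R(T^k)]. As [R(T^k)] is closed, the Hahn-Banach theorem gives a bounded
    functional [f] that vanishes on [R(T^k)] and on [x, ..., T^(p-1) x], with
    [f (T^p x) = 1] ([block_exists]). Then [{v | f (T^j v) = 0 for all j}] is a
    closed invariant complement of the span of [x, ..., T^p x] ([block_dec]).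
    Removing the block lowers the dimensions of [N_n] and of
    [R(T^n) / R(T^(n+1))] by one for [n <= p] and changes neither afterwards
    ([alpha_block], [beta_block]), hence keeps [m] and the index. The closedness
    of [R(T^n)] for all [n >= m] follows from the open mapping theorem
    ([closed_ranges_alpha], [closed_ranges_beta]).

    It remains to see that the jump of [T_M] is 0 when its kernels are stable from
    [m] on. For [mu <> 0], [T_M - mu] has the same kernel and cokernel dimensions
    as its restriction to [V = R(T_M^m)], and the kernel of [T] in [V] lies in the
    range of every power. Let [W] be the intersection of the ranges of the powers
    of [T] on [V]. Then [T W = W], preimages in [V] of points of [W] are in [W],
    and [N(T_V - mu)] is contained in [W]. On [W], [T] is onto with a lifting
    constant as close to the inverse of [gamma] as wanted, so by a Neumann series
    [T - mu] is onto for all [|mu| < gamma], with a bound that is uniform on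
    smaller discs ([core_shift_lift]). Modulo [W], [T] is bounded below, by
    [gamma], and so is [T - mu], again uniformly
    ([shift_bounded_below_mod_core]). Both facts are stable under steps of [mu]
    whose length depends only on these bounds and on the number of vectors moved:
    a free family in the kernel, or modulo the range, at [mu] gives one of the
    same length at [nu]. A finite chain of such steps joins 0 to any point of the
    disc, so both dimensions are constant there ([indep_ker_shift],
    [indep_coker_shift]). This gives the full radius [gamma] without any
    compactness argument. *)

(** * The real-valued norm and geometric sequences *)
Section Norm.
Context {R : realType} {X : completeNormedModType R[i]}.
Implicit Types (x y z : X) (a c : R[i]) (V W : set X).

Definition cabs c : R := complex.Re `|c|.

Lemma cabsE c : `|c| = (cabs c)%:C.
Proof. by rewrite /cabs normc_def. Qed.

Lemma normE x : `|x| = (norm x)%:C.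
Proof. by rewrite /norm RRe_real // ger0_real. Qed.

Lemma norm_ge0 x : 0 <= norm x.
Proof. by rewrite -ler0c -normE. Qed.

Lemma cabs_ge0 c : 0 <= cabs c.
Proof. by rewrite -ler0c -cabsE. Qed.

Lemma norm0 : norm (0 : X) = 0.
Proof. by rewrite /norm normr0. Qed.

Lemma norm_eq0 x : norm x = 0 -> x = 0.
Proof. by move=> x0; apply/eqP; rewrite -normr_eq0 normE x0. Qed.

Lemma normN x : norm (- x) = norm x.
Proof. by rewrite /norm normrN. Qed.

Lemma normB_sym x y : norm (x - y) = norm (y - x).
Proof. by rewrite -normN opprB. Qed.

Lemma normD x y : norm (x + y) <= norm x + norm y.
Proof. by rewrite -lecR rmorphD /= -!normE ler_normD. Qed.

Lemma normB x y : norm (x - y) <= norm x + norm y.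
Proof. by rewrite -(normN y) normD. Qed.

Lemma normZ c x : norm (c *: x) = cabs c * norm x.
Proof. by apply: (@complexI R); rewrite rmorphM /= -normE -cabsE -normE normrZ. Qed.

Lemma norm_gt0 x : x <> 0 -> 0 < norm x.
Proof.
move=> x0; rewrite lt_neqAle norm_ge0 andbT eq_sym; apply/eqP => /norm_eq0.
exact: x0.
Qed.

Lemma cabsM a c : cabs (a * c) = cabs a * cabs c.
Proof. by apply: (@complexI R); rewrite rmorphM /= -!cabsE normrM. Qed.

Lemma cabsD a c : cabs (a + c) <= cabs a + cabs c.
Proof. by rewrite -lecR rmorphD /= -!cabsE ler_normD. Qed.

Lemma cabsN c : cabs (- c) = cabs c.
Proof. by rewrite /cabs normrN. Qed.

Lemma cabsR (r : R) : 0 <= r -> cabs r%:C = r.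
Proof. by move=> r0; apply: (@complexI R); rewrite -cabsE ger0_norm // ler0c. Qed.

Lemma cabs0 : cabs 0 = 0.
Proof. by rewrite /cabs normr0. Qed.

Lemma cabs1 : cabs 1 = 1.
Proof. by rewrite /cabs normr1. Qed.

Lemma cabs_eq0 c : cabs c = 0 -> c = 0.
Proof. by move=> c0; apply/eqP; rewrite -normr_eq0 cabsE c0. Qed.

Lemma cabs_gt0 c : c <> 0 -> 0 < cabs c.
Proof.
move=> c0; rewrite lt_neqAle cabs_ge0 andbT eq_sym; apply/eqP => /cabs_eq0.
exact: c0.
Qed.

Lemma cabsV c : cabs c^-1 = (cabs c)^-1.
Proof.
have [->|/eqP c0] := eqVneq c 0; first by rewrite invr0 cabs0 invr0.
have p := cabs_gt0 c0.
apply: (mulfI (lt0r_neq0 p)); rewrite -cabsM divff ?cabs1 ?divff //; last exact/eqP.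
exact: lt0r_neq0.
Qed.

Lemma norm_sum n (F : 'I_n -> X) :
  norm (\sum_(i < n) F i) <= \sum_(i < n) norm (F i).
Proof.
elim/big_ind2: _ => [|x u y v xu yv|//]; first by rewrite norm0.
by rewrite (le_trans (normD _ _)) // lerD.
Qed.

Lemma ball_norm x (e : R) : 0 < e -> nbhs x [set y | norm (x - y) < e].
Proof.
move=> e0; apply/nbhs_ballP; exists e%:C; first by rewrite /= -[0]/(0%:C) ltcR.
by move=> y; rewrite -ball_normE /= normE ltcR.
Qed.

Lemma nbhs_normP x (A : set X) :
  nbhs x A -> exists2 e : R, 0 < e & forall y, norm (x - y) < e -> A y.
Proof.
move=> /nbhs_ballP[e /= e0 xA]; exists (complex.Re e).
  by move: e0; rewrite ltcE => /andP[].
move=> y xy; apply: xA; rewrite -ball_normE /= normE ltcE /=.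
by move: e0; rewrite ltcE /= => /andP[/eqP -> _]; rewrite eqxx.
Qed.

Lemma closed_approx V x : closed V ->
  (forall e : R, 0 < e -> exists2 y, V y & norm (x - y) < e) -> V x.
Proof.
move=> cV h; apply: cV => B /nbhs_normP[e e0 eB].
by have [y Vy xy] := h e e0; exists y; split => //; apply: eB.
Qed.

Lemma approx_closed V :
  (forall x, (forall e : R, 0 < e -> exists2 y, V y & norm (x - y) < e) -> V x) ->
  closed V.
Proof.
move=> h x cx; apply: h => e e0.
by have [y [Vy /= xy]] := cx _ (ball_norm x e0); exists y.
Qed.

Lemma geometric_small (C q e : R) : 0 <= C -> 0 <= q -> q < 1 -> 0 < e ->
  exists n, C * q ^+ n < e.
Proof.
move=> C0 q0 q1 e0.
have /cvgrPdist_lt /(_ (e / (C + 1))) : (fun n => q ^+ n) @ \oo --> (0 : R).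
  by apply: cvg_expr; rewrite ger0_norm.
have Cp : 0 < C + 1 by rewrite ltr_wpDl.
case; first by rewrite divr_gt0.
move=> n _ /(_ n (leqnn n)) /=; rewrite sub0r normrN ger0_norm ?exprn_ge0 //.
rewrite ltr_pdivlMr // => qn; exists n.
apply: le_lt_trans qn; rewrite mulrC ler_wpM2l ?exprn_ge0 //.
by rewrite lerDl.
Qed.

Lemma geometric_le0 (a C q : R) : 0 <= C -> 0 <= q -> q < 1 ->
  (forall n, a <= C * q ^+ n) -> a <= 0.
Proof.
move=> C0 q0 q1 h; rewrite leNgt; apply/negP => a0.
by have [n] := geometric_small C0 q0 q1 a0; rewrite ltNge h.
Qed.

(** Completeness in the only form needed below, with the rate of convergence. *)
Lemma geometric_cvg (u : nat -> X) (C q : R) : 0 <= q -> q < 1 ->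
  (forall n, norm (u n.+1 - u n) <= C * q ^+ n) ->
  exists l, forall n, norm (l - u n) <= C * q ^+ n / (1 - q).
Proof.
move=> q0 q1 h.
have q1' : 0 < 1 - q by rewrite subr_gt0.
have C0 : 0 <= C.
  by apply: le_trans (norm_ge0 (u 1%N - u 0%N)) _; have := h 0%N; rewrite expr0 mulr1.
have tail n k : norm (u (n + k)%N - u n) <= C * q ^+ n / (1 - q) * (1 - q ^+ k).
  elim: k => [|k IH]; first by rewrite addn0 subrr norm0 expr0 subrr mulr0.
  have -> : u (n + k.+1)%N - u n = (u (n + k.+1)%N - u (n + k)%N) + (u (n + k)%N - u n).
    by rewrite addrA subrK.
  apply: le_trans (normD _ _) _; rewrite addnS.
  apply: le_trans (lerD (h _) IH) _.
  rewrite le_eqVlt; apply/orP; left; apply/eqP; rewrite exprD exprS.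
  by field; apply: lt0r_neq0.
have tail' n k : (n <= k)%N -> norm (u k - u n) <= C * q ^+ n / (1 - q).
  move=> nk; rewrite -(subnKC nk); apply: le_trans (tail _ _) _.
  rewrite ler_piMr //; last by rewrite gerBl exprn_ge0.
  by rewrite divr_ge0 ?mulr_ge0 ?exprn_ge0 // ltW.
have small (e : R) : 0 < e -> exists n, C * q ^+ n / (1 - q) < e.
  move=> e0; have [//|n nP] := geometric_small (C := C / (1 - q)) _ q0 q1 e0.
    by rewrite divr_ge0 // ltW.
  by exists n; rewrite mulrAC.
have : cvg (u @ \oo).
  apply/cauchy_cvgP/cauchy_exP => e e0.
  have [E eE] : exists E : R, e = E%:C.
    by exists (complex.Re e); rewrite RRe_real // gtr0_real.
  have E0 : 0 < E by rewrite -ltcR -eE.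
  have [n nE] := small _ E0.
  exists (u n); exists n => // k /= nk; rewrite -ball_normE /= normE eE ltcR.
  by rewrite normB_sym; apply: le_lt_trans nE; apply: tail'.
move=> /cvg_ex[l ul]; exists l => n.
apply/ler_addgt0Pr => e e0.
have [N _ uN] := ul _ (ball_norm l e0).
have := uN (maxn N n) (leq_maxl _ _) => /= lN.
have -> : l - u n = (l - u (maxn N n)) + (u (maxn N n) - u n).
  by rewrite addrA subrK.
apply: le_trans (normD _ _) _; rewrite [leRHS]addrC.
by apply: lerD; [exact: ltW | apply: tail'; rewrite leq_maxr].
Qed.

Lemma continuous_bounded (T : {linear X -> X}) : continuous T ->
  exists2 K : R, 0 <= K & forall x, norm (T x) <= K * norm x.
Proof.
move=> /(_ 0) T0.
have /nbhs_normP[e e0 eT] : nbhs (0 : X) [set x | norm (T x) < 1].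
  have := T0 [set y | norm y < 1]; apply.
  rewrite linear0; apply: filterS (ball_norm _ ltr01) => y /=.
  by rewrite sub0r normN.
exists (2 / e); first by rewrite divr_ge0 // ltW.
move=> x; have [->|/eqP x0] := eqVneq x 0; first by rewrite linear0 norm0 mulr0.
have nx := norm_gt0 x0.
have r0 : 0 <= e / 2 / norm x by rewrite !divr_ge0 // ltW.
have := eT ((e / 2 / norm x)%:C *: x); rewrite /= sub0r normN linearZ /= !normZ cabsR //.
rewrite divfK ?lt0r_neq0 // => /(_ _) H.
have /H : e / 2 < e by lra.
rewrite -ltr_pdivlMl ?divr_gt0 // mulr1 => /ltW /le_trans; apply.
by rewrite le_eqVlt; apply/orP; left; apply/eqP; field; rewrite !lt0r_neq0.
Qed.

End Norm.

(** * Subspaces and the open mapping theorem *)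
Section Subspaces.
Context {K : nzRingType} {U : lmodType K}.
Implicit Types (V : set U).

Definition subsp V := V 0 /\ forall a x y, V x -> V y -> V (a *: x + y).

Context {V : set U} (sV : subsp V).

Lemma subsp0 : V 0. Proof. by case: sV. Qed.

Lemma subspD x y : V x -> V y -> V (x + y).
Proof. by move=> Vx Vy; rewrite -[x]scale1r; apply: sV.2. Qed.

Lemma subspZ a x : V x -> V (a *: x).
Proof. by move=> Vx; rewrite -[a *: x]addr0; apply: sV.2 => //; apply: subsp0. Qed.

Lemma subspN x : V x -> V (- x).
Proof. by move=> Vx; rewrite -scaleN1r; apply: subspZ. Qed.

Lemma subspB x y : V x -> V y -> V (x - y).
Proof. by move=> Vx Vy; apply: subspD => //; apply: subspN. Qed.

Lemma subsp_sum n (F : 'I_n -> U) : (forall i, V (F i)) -> V (\sum_i F i).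
Proof.
by move=> VF; elim/big_ind: _ => //; [exact: subsp0 | exact: subspD].
Qed.

End Subspaces.

Section OpenMapping.
Context {R : realType}.

(** A complete domain for the open mapping theorem. The norm is a parameter and
    completeness is restricted to geometric sequences, so that one statement
    covers closed subspaces and products of two of them. *)
Record banach_set (U : lmodType R[i]) (V : set U) (nu : U -> R) : Prop := {
  bs_subsp : subsp V;
  bs_triangle : forall x y, nu (x + y) <= nu x + nu y;
  bs_scale : forall a x, nu (a *: x) = cabs a * nu x;
  bs_complete : forall (u : nat -> U) (C q : R), 0 <= q -> q < 1 ->
    (forall n, V (u n)) -> (forall n, nu (u n.+1 - u n) <= C * q ^+ n) ->
    exists2 l, V l & forall n, nu (l - u n) <= C * q ^+ n / (1 - q) }.

Context {X : completeNormedModType R[i]}.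

Lemma closed_banach_set (V : set X) : subsp V -> closed V -> banach_set V norm.
Proof.
move=> sV cV; split => //; [exact: normD|exact: normZ|].
move=> u C q q0 q1 Vu h; have [l ul] := geometric_cvg q0 q1 h.
have C0 : 0 <= C.
  by apply: le_trans (norm_ge0 (u 1%N - u 0%N)) _; have := h 0%N; rewrite expr0 mulr1.
exists l => //; apply: closed_approx => // e e0.
have [n nP] : exists n, C / (1 - q) * q ^+ n < e.
  by apply: geometric_small => //; rewrite divr_ge0 // subr_ge0 ltW.
by exists (u n) => //; apply: le_lt_trans nP; rewrite mulrAC.
Qed.

Lemma prod_banach_set (U1 U2 : lmodType R[i]) (V1 : set U1) (V2 : set U2) nu1 nu2 :
  banach_set V1 nu1 -> banach_set V2 nu2 ->
  banach_set (V1 `*` V2) (fun p : U1 * U2 => Num.max (nu1 p.1) (nu2 p.2)).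
Proof.
move=> [s1 t1 h1 c1] [s2 t2 h2 c2]; split.
- split; first by split; apply: subsp0.
  by move=> a [x1 x2] [y1 y2] [/= ? ?] [/= ? ?]; split => /=; [apply: s1.2|apply: s2.2].
- move=> x y /=; rewrite ge_max; apply/andP; split.
    by apply: le_trans (t1 _ _) _; apply: lerD; rewrite le_max lexx.
  by apply: le_trans (t2 _ _) _; apply: lerD; rewrite le_max lexx orbT.
- move=> a x /=; rewrite h1 h2 maxr_pMr //; exact: cabs_ge0.
move=> u C q q0 q1 Vu h.
have n1 n : nu1 ((u n.+1).1 - (u n).1) <= C * q ^+ n.
  by apply: le_trans (h n); rewrite le_max lexx.
have n2 n : nu2 ((u n.+1).2 - (u n).2) <= C * q ^+ n.
  by apply: le_trans (h n); rewrite le_max lexx orbT.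
have [l1 Vl1 e1] := c1 _ _ _ q0 q1 (fun n => (Vu n).1) n1.
have [l2 Vl2 e2] := c2 _ _ _ q0 q1 (fun n => (Vu n).2) n2.
by exists (l1, l2) => // n; rewrite ge_max e1 e2.
Qed.

(** Solving [A x = y] up to a fixed proportion of [y] is enough: applying it
    again to the error gives a geometric series of corrections. This is used for
    the open mapping theorem and, with [T - mu] for [A], as a Neumann series. *)
Lemma approx_lifting (U : lmodType R[i]) (V : set U) nu (A : {linear U -> X})
    (Y : set X) (K c q : R) :
  banach_set V nu -> 0 <= K -> (forall x, V x -> norm (A x) <= K * nu x) ->
  0 <= c -> 0 <= q -> q < 1 ->
  (forall y, Y y -> exists x, [/\ V x, nu x <= c * norm y,
     Y (y - A x) & norm (y - A x) <= q * norm y]) ->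
  forall y, Y y -> exists x, [/\ V x, A x = y & nu x <= c / (1 - q) * norm y].
Proof.
move=> bV K0 bA c0 q0 q1 h y Yy; have sV := bs_subsp bV.
have [s sP] : {s & forall y, Y y -> [/\ V (s y), nu (s y) <= c * norm y,
     Y (y - A (s y)) & norm (y - A (s y)) <= q * norm y]}.
  apply: (@choice _ _ (fun y x => Y y -> [/\ V x, nu x <= c * norm y,
     Y (y - A x) & norm (y - A x) <= q * norm y])) => z.
  by have [/h[x ?]|nYz] := pselect (Y z); [exists x|exists 0].
pose r n := iter n (fun z => z - A (s z)) y.
have rS n : r n.+1 = r n - A (s (r n)) by [].
have Yr n : Y (r n) by elim: n => [//|n /sP[]].
have nr n : norm (r n) <= norm y * q ^+ n.
  elim: n => [|n IH]; first by rewrite expr0 mulr1.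
  have [_ _ _ le] := sP _ (Yr n); apply: le_trans le _.
  by rewrite exprS mulrCA ler_wpM2l.
pose u n := \sum_(i < n) s (r i).
have Vu n : V (u n) by apply: subsp_sum => // i; have [] := sP _ (Yr i).
have uS n : u n.+1 - u n = s (r n) by rewrite /u big_ord_recr /= addrAC subrr add0r.
have Au n : A (u n) = y - r n.
  elim: n => [|n IH]; first by rewrite /u big_ord0 linear0 subrr.
  by rewrite -[u n.+1](subrK (u n)) uS linearD IH rS opprB addrCA.
have [l Vl lP] : exists2 l, V l & forall n, nu (l - u n) <= (c * norm y) * q ^+ n / (1 - q).
  apply: (bs_complete bV) => // n; rewrite uS.
  have [_ le _ _] := sP _ (Yr n); apply: le_trans le _.
  by rewrite -mulrA ler_wpM2l.
exists l; split => //; last first.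
  by have := lP 0%N; rewrite /u big_ord0 subr0 expr0 mulr1 mulrAC.
apply/eqP; rewrite eq_sym -subr_eq0; apply/eqP/norm_eq0/le_anti; rewrite norm_ge0 andbT.
have D0 : 0 <= norm y + K * (c * norm y / (1 - q)).
  by rewrite addr_ge0 ?mulr_ge0 ?norm_ge0 // invr_ge0 subr_ge0 ltW.
apply: (geometric_le0 D0 q0 q1) => n.
have -> : y - A l = r n - A (l - u n).
  by rewrite linearB Au opprB addrA (addrC (r n)) subrK.
apply: le_trans (normB _ _) _; rewrite mulrDl; apply: lerD => //.
apply: le_trans (bA _ _) _; first exact: subspB.
by rewrite -mulrA ler_wpM2l // mulrAC.
Qed.

(** A limit [y] of points of the range is solved up to [y / 2] by lifting a nearby
    point, so [approx_lifting] applies to the whole closure. *)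
Lemma closed_of_lifting (U : lmodType R[i]) (V : set U) nu (A : {linear U -> X})
    (K c : R) :
  banach_set V nu -> 0 <= K -> (forall x, V x -> norm (A x) <= K * nu x) -> 0 <= c ->
  (forall x, V x -> exists x', [/\ V x', A x' = A x & nu x' <= c * norm (A x)]) ->
  closed (A @` V).
Proof.
move=> bV K0 bA c0 h; have sV := bs_subsp bV.
pose Y : set X := [set y | forall e : R, 0 < e -> exists2 x, V x & norm (y - A x) < e].
apply: approx_closed => y Yy0; have Yy : Y y.
  by move=> e /Yy0[_ [x Vx <-] ?]; exists x.
have := @approx_lifting U V nu A Y K (c * (3 / 2)) (1 / 2) bV K0 bA.
move=> H; suff {H} : forall z, Y z -> exists x, [/\ V x, nu x <= c * (3 / 2) * norm z,
     Y (z - A x) & norm (z - A x) <= 1 / 2 * norm z].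
  move=> H2; have [|||x [Vx Ax _]] := H _ _ _ H2 y Yy; [lra|lra|lra|].
  by exists x.
move=> z Yz; have [->|/eqP z0] := eqVneq z 0.
  exists 0; rewrite linear0 subr0 norm0 !mulr0; split => //; first exact: subsp0.
  - have := bs_scale bV 0 0; rewrite scale0r cabs0 mul0r => -> //.
  - move=> e e0; exists 0; first exact: subsp0.
    by rewrite linear0 subr0 norm0.
have nz := norm_gt0 z0; have [|x Vx zx] := Yz (1 / 2 * norm z); first lra.
have [x' [Vx' Axx' nx']] := h _ Vx; exists x'; rewrite Axx'; split => //.
- apply: le_trans nx' _; rewrite -mulrA ler_wpM2l //.
  have := normD (z - A x) (- z); rewrite addrAC subrr add0r !normN; lra.
- move=> e /Yz[x2 Vx2 zx2]; exists (x2 - x); first exact: subspB.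
  by rewrite linearB opprB addrA subrK.
- exact: ltW.
Qed.

(** Nested balls whose centres stay in [Y], so that the limit belongs to [Y]. *)
Lemma baire_closed (Y : set X) (F : nat -> set X) : Y !=set0 -> closed Y ->
  (forall n, closed (F n)) -> (forall y, Y y -> exists n, F n y) ->
  exists n y0 (r : R), [/\ Y y0, 0 < r & forall y, Y y -> norm (y - y0) < r -> F n y].
Proof.
move=> [y0 Yy0] cY cF cov; apply: contrapT => bad.
have step (n : nat) (y : X) (r : R) : exists p : X * R, Y y -> 0 < r ->
    [/\ Y p.1, 0 < p.2, p.2 <= r / 2, norm (p.1 - y) + p.2 <= r &
     forall z, norm (p.1 - z) <= p.2 -> ~ F n z].
  have [[Yy r0]|nYr] := pselect (Y y /\ 0 < r); last first.
    by exists (y, r) => Yy r0; exfalso; apply: nYr.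
  have [z [Yz zy nF]] : exists z, [/\ Y z, norm (z - y) < r / 2 & ~ F n z].
    apply: contrapT => nex; apply: bad; exists n, y, (r / 2); split => //; first lra.
    by move=> z Yz zy; apply: contrapT => nF; apply: nex; exists z.
  have [e e0 eF] : exists2 e : R, 0 < e & forall w, norm (z - w) < e -> ~ F n w.
    apply: contrapT => nex; apply: nF; apply: closed_approx => // e e0.
    apply: contrapT => nw; apply: nex; exists e => // w zw Fw.
    by apply: nw; exists w.
  have m0 : 0 < Num.min (r / 2) (e / 2) by rewrite lt_min; apply/andP; split; lra.
  exists (z, Num.min (r / 2) (e / 2)) => _ _ /=; split => //.
  - by rewrite ge_min lexx.
  - have : Num.min (r / 2) (e / 2) <= r / 2 by rewrite ge_min lexx.
    lra.
  - move=> w zw; apply: eF; apply: le_lt_trans zw _.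
    have : Num.min (r / 2) (e / 2) <= e / 2 by rewrite ge_min lexx orbT.
    lra.
have [g gP] : {g : nat * X * R -> X * R & forall t, Y t.1.2 -> 0 < t.2 ->
    [/\ Y (g t).1, 0 < (g t).2, (g t).2 <= t.2 / 2, norm ((g t).1 - t.1.2) + (g t).2 <= t.2 &
     forall z, norm ((g t).1 - z) <= (g t).2 -> ~ F t.1.1 z]}.
  apply: (@choice _ _ (fun t p => Y t.1.2 -> 0 < t.2 ->
    [/\ Y p.1, 0 < p.2, p.2 <= t.2 / 2, norm (p.1 - t.1.2) + p.2 <= t.2 &
     forall z, norm (p.1 - z) <= p.2 -> ~ F t.1.1 z])) => -[[n y] r]; exact: step.
pose s := fix s n : X * R := if n is m.+1 then g (m, (s m).1, (s m).2) else (y0, 1).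
have Ys n : Y (s n).1 /\ 0 < (s n).2.
  by elim: n => [|n [Yn rn]] //=; have [] := gP (n, (s n).1, (s n).2) Yn rn.
have sP n := gP (n, (s n).1, (s n).2) (Ys n).1 (Ys n).2.
have rad n : (s n).2 <= (1 / 2) ^+ n.
  elim: n => [|n IH]; first by rewrite expr0.
  have [_ _ h _ _] := sP n; apply: le_trans h _; rewrite exprS /=; lra.
have [l lP] : exists l, forall n, norm (l - (s n).1) <= 2 * (1 / 2) ^+ n.
  have [||n|l lP] := @geometric_cvg _ _ (fun n => (s n).1) 1 (1 / 2); [lra|lra| |].
    rewrite [leRHS]mul1r; apply: le_trans _ (rad n).
    by have [_ r0 _ h _] := sP n; rewrite /= in h r0 *; lra.
  exists l => n; apply: le_trans (lP n) _; rewrite mul1r mulrC.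
  by rewrite (_ : (1 - 1 / 2)^-1 = 2) //; field.
have nest n k : norm ((s (n + k)%N).1 - (s n).1) + (s (n + k)%N).2 <= (s n).2.
  elim: k => [|k IH]; first by rewrite addn0 subrr norm0 add0r.
  have [_ r0 _ h _] := sP (n + k)%N; rewrite addnS /= in h r0 *.
  set t := g _ in h r0 *.
  have := normD (t.1 - (s (n + k)%N).1) ((s (n + k)%N).1 - (s n).1).
  rewrite addrA subrK; lra.
have near n : norm ((s n).1 - l) <= (s n).2.
  apply/ler_addgt0Pr => e e0.
  have [k kP] : exists k, 2 * (1 / 2 : R) ^+ n * (1 / 2) ^+ k < e.
    by apply: geometric_small => //; rewrite ?mulr_ge0 ?exprn_ge0 //; lra.
  have := lP (n + k)%N; rewrite exprD => h.
  have h2 := nest n k; have [_ r0] := Ys (n + k)%N.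
  have := normB ((s n).1 - (s (n + k)%N).1) (l - (s (n + k)%N).1).
  rewrite opprB addrA subrK (normB_sym (s n).1); lra.
have Yl : Y l.
  apply: closed_approx => // e e0.
  have [n nP] : exists n, 2 * (1 / 2 : R) ^+ n < e.
    by apply: geometric_small => //; lra.
  by exists (s n).1; [exact: (Ys n).1 | exact: le_lt_trans (lP n) _].
have [n Fn] := cov l Yl.
by have [_ _ _ _ /(_ l (near n.+1))] := sP n.
Qed.

(** The open mapping theorem. Baire's theorem makes some closure of the image of a
    ball contain a ball around a point [y0] of the range; differences recentre it
    at 0, and [approx_lifting] removes the closure. *)
Lemma open_mapping (U : lmodType R[i]) (V : set U) nu (A : {linear U -> X}) (K : R) :
  banach_set V nu -> 0 <= K -> (forall x, V x -> norm (A x) <= K * nu x) ->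
  closed (A @` V) ->
  exists2 c : R, 0 <= c &
    forall x, V x -> exists x', [/\ V x', A x' = A x & nu x' <= c * norm (A x)].
Proof.
move=> bV K0 bA cY; have sV := bs_subsp bV; set Y := A @` V in cY *.
have sY : subsp Y.
  split; first by exists 0; [exact: subsp0 | rewrite linear0].
  move=> a _ _ [x Vx <-] [y Vy <-]; exists (a *: x + y); first exact: sV.2.
  by rewrite linearP.
pose F n : set X := [set y | forall e : R, 0 < e ->
  exists x, [/\ V x, nu x <= n%:R & norm (y - A x) < e]].
have [n [y0 [r [Yy0 r0 Fr]]]] : exists n y0 (r : R),
    [/\ Y y0, 0 < r & forall y, Y y -> norm (y - y0) < r -> F n y].
  apply: baire_closed => //.
  - by exists 0; apply: subsp0.
  - move=> n; apply: approx_closed => y h e e0.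
    have [|z Fz yz] := h (e / 2); first lra.
    have [|x [Vx nx zx]] := Fz (e / 2); first lra.
    exists x; split => //; have := normD (y - z) (z - A x).
    rewrite addrA subrK; lra.
  - move=> _ [x Vx <-]; exists (Num.bound `|nu x|) => e e0; exists x; split => //.
      by apply: le_trans (ler_norm _) (ltW _); rewrite archi_boundP ?normr_ge0.
    by rewrite subrr norm0.
have near z (e : R) : Y z -> norm z < r -> 0 < e ->
    exists x, [/\ V x, nu x <= 2 * n%:R & norm (z - A x) < e].
  move=> Yz zr e0; have e2 : 0 < e / 2 by lra.
  have [|x1 [V1 n1 h1]] := Fr (y0 + z) (subspD sY Yy0 Yz) _ _ e2.
    by rewrite addrAC subrr add0r.
  have [|x2 [V2 n2 h2]] := Fr y0 Yy0 _ _ e2; first by rewrite subrr norm0.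
  exists (x1 - x2); split; first exact: subspB.
    have := bs_triangle bV x1 (- x2); rewrite -(scaleN1r x2) (bs_scale bV).
    rewrite cabsN cabs1; lra.
  have -> : z - A (x1 - x2) = (y0 + z - A x1) - (y0 - A x2).
    by rewrite linearB -(addrA y0) [in RHS](addrC y0) addrKA opprK opprB addrA addrAC.
  have := normB (y0 + z - A x1) (y0 - A x2); lra.
have := @approx_lifting U V nu A Y K (2 * n%:R * (2 / r)) (1 / 2) bV K0 bA.
have h12 : 0 <= 1 - 1 / 2 :> R by lra.
have h02 : 0 <= 1 / 2 :> R by lra.
have h21 : 1 / 2 < 1 :> R by lra.
have n0 : 0 <= (n%:R : R) by rewrite ler0n.
have c0 : 0 <= 2 * n%:R * (2 / r) by rewrite !mulr_ge0 // invr_ge0 ltW.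
move=> H; exists (2 * n%:R * (2 / r) / (1 - 1 / 2)).
  apply: divr_ge0; [exact: c0 | exact: h12].
move=> x Vx; apply: (H c0 h02 h21); last by exists x.
move=> y Yy; have [->|/eqP yn0] := eqVneq y 0.
  exists 0; rewrite linear0 subr0 norm0 !mulr0; split => //.
  - exact: subsp0.
  - by have := bs_scale bV 0 0; rewrite scale0r cabs0 mul0r => ->.
  - exact: subsp0.
have ny := norm_gt0 yn0; pose t := r / 2 / norm y.
have t0 : 0 < t by rewrite !divr_gt0.
have ty : t * norm y = r / 2 by rewrite divfK ?lt0r_neq0.
have [||x' [Vx' nx' hx']] := near (t%:C *: y) (r / 4) (subspZ sY _ Yy).
- by rewrite normZ cabsR ?(ltW t0) // ty; lra.
- lra.
have tV : cabs t^-1%:C = t^-1 by rewrite cabsR // invr_ge0 ltW.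
have yE : y - A (t^-1%:C *: x') = t^-1%:C *: (t%:C *: y - A x').
  rewrite linearZ scalerBr scalerA -rmorphM mulVf ?scale1r //.
  exact: lt0r_neq0.
have ti : t^-1 = norm y * (2 / r).
  by rewrite /t; field; rewrite !lt0r_neq0.
exists (t^-1%:C *: x'); split.
- exact: subspZ.
- rewrite (bs_scale bV) tV.
  have -> : 2 * n%:R * (2 / r) * norm y = t^-1 * (2 * n%:R) by rewrite ti; ring.
  by rewrite ler_wpM2l // invr_ge0 ltW.
- apply: subspB => //; exists (t^-1%:C *: x') => //; exact: subspZ.
rewrite yE normZ tV.
have -> : 1 / 2 * norm y = t^-1 * (r / 4) by rewrite ti; field; exact: lt0r_neq0.
by rewrite ler_wpM2l ?invr_ge0 // ltW.
Qed.

End OpenMapping.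

(** * Dimension of a quotient *)
Section NatInf.
Implicit Types P : set nat.

Lemma natinf_eq P n : P n -> (forall k, P k -> (n <= k)%N) -> natinf P = (n%:Z)%:E.
Proof.
move=> Pn nP; rewrite /natinf; case: asboolP => [_|]; last by case; exists n.
congr (_%:Z%:E); case: xgetP => [k _ [Pk kP]|/(_ n) /= h]; last by case: h.
by apply/eqP; rewrite eqn_leq kP // nP.
Qed.

Lemma natinf_min P n : P n ->
  exists k, [/\ natinf P = (k%:Z)%:E, P k & forall j, P j -> (k <= j)%N].
Proof.
move=> Pn; have exP : exists n, `[< P n >] by exists n; apply/asboolP.
have [k /asboolP Pk kP] := ex_minnP exP.
have kP' j : P j -> (k <= j)%N by move=> Pj; apply: kP; apply/asboolP.
by exists k; split => //; apply: natinf_eq.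
Qed.

Lemma natinf_lty P : (natinf P < +oo)%E -> exists n, P n.
Proof.
by rewrite /natinf; case: asboolP => [[n Pn] _|//]; exists n.
Qed.

Lemma natinf_pinfty P : (forall n, ~ P n) -> natinf P = +oo%E.
Proof. by move=> h; rewrite /natinf; case: asboolP => // -[n /h]. Qed.

End NatInf.

Section Dimension.
Context {R : realType} {X : completeNormedModType R[i]}.
Implicit Types (V W A B : set X).

Definition lincomb n (c : 'rV[R[i]]_n) (e : 'I_n -> X) : X :=
  \sum_(i < n) c 0 i *: e i.

Definition free_mod W n (e : 'I_n -> X) := forall c, W (lincomb c e) -> c = 0.

Definition spans_mod V W n (e : 'I_n -> X) :=
  forall v, V v -> exists c, W (v - lincomb c e).

(** Dimensions are compared through the lengths of free families: this is
    meaningful in finite and infinite dimension alike, and it passes to subspaces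
    without choosing bases. *)
Definition indep V W n := exists2 e : 'I_n -> X, (forall i, V (e i)) & free_mod W e.

Lemma lincombD n (c d : 'rV[R[i]]_n) e :
  lincomb (c + d) e = lincomb c e + lincomb d e.
Proof. by rewrite -big_split; apply: eq_bigr => i _; rewrite mxE scalerDl. Qed.

Lemma lincombZ n a (c : 'rV[R[i]]_n) e : lincomb (a *: c) e = a *: lincomb c e.
Proof. by rewrite scaler_sumr; apply: eq_bigr => i _; rewrite mxE scalerA. Qed.

Lemma lincombN n (c : 'rV[R[i]]_n) e : lincomb (- c) e = - lincomb c e.
Proof. by rewrite -scaleN1r lincombZ scaleN1r. Qed.

Lemma lincombB n (c d : 'rV[R[i]]_n) e :
  lincomb (c - d) e = lincomb c e - lincomb d e.
Proof. by rewrite lincombD lincombN. Qed.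

Lemma lincomb0 n e : lincomb (0 : 'rV_n) e = 0.
Proof. by rewrite -(scale0r 0) lincombZ scale0r. Qed.

Lemma lincomb_in V n (c : 'rV[R[i]]_n) e : subsp V -> (forall i, V (e i)) ->
  V (lincomb c e).
Proof. by move=> sV Ve; apply: subsp_sum => // i; apply: subspZ. Qed.

Lemma linear_lincomb (T : {linear X -> X}) n (c : 'rV[R[i]]_n) e :
  T (lincomb c e) = lincomb c (T \o e).
Proof. by rewrite linear_sum; apply: eq_bigr => i _; rewrite linearZ. Qed.

(** Adjoining a vector in front of a family, and its coefficient in front of a
    row, so that free families are extended one vector at a time. *)
Definition cons_row n a (c : 'rV[R[i]]_n) : 'rV[R[i]]_n.+1 :=
  \row_i oapp (fun j => c 0 j) a (unlift ord0 i).

Definition cons_fam n (x : X) (e : 'I_n -> X) : 'I_n.+1 -> X :=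
  fun i => oapp e x (unlift ord0 i).

Lemma lincomb_cons n a (c : 'rV[R[i]]_n) x e :
  lincomb (cons_row a c) (cons_fam x e) = a *: x + lincomb c e.
Proof.
rewrite /lincomb big_ord_recl mxE /cons_fam unlift_none /=; congr (_ + _).
by apply: eq_bigr => i _; rewrite mxE liftK.
Qed.

Lemma row_cons n (c : 'rV[R[i]]_n.+1) :
  c = cons_row (c 0 ord0) (\row_i c 0 (lift ord0 i)).
Proof.
apply/rowP => i; rewrite [RHS]mxE.
by case: (unliftP ord0 i) => [j ->|->] /=; [rewrite [RHS]mxE|].
Qed.

Lemma cons_row0 n : cons_row 0 (0 : 'rV_n) = 0.
Proof. by apply/rowP => i; rewrite !mxE; case: (unliftP ord0 i) => [j _|_] /=; rewrite ?mxE. Qed.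

Lemma cons_fam_in V n x (e : 'I_n -> X) : V x -> (forall i, V (e i)) ->
  forall i, V (cons_fam x e i).
Proof. by move=> Vx Ve i; rewrite /cons_fam; case: (unliftP ord0 i) => [j _|_] /=. Qed.

Lemma indep0 V W : indep V W 0.
Proof. by exists (fun=> 0) => [[]//|c _]; apply/rowP => -[]. Qed.

Lemma indep_cons V W n x (e : 'I_n -> X) : V x -> (forall i, V (e i)) ->
  (forall a c, W (a *: x + lincomb c e) -> a = 0 /\ c = 0) -> indep V W n.+1.
Proof.
move=> Vx Ve h; exists (cons_fam x e); first exact: cons_fam_in.
by move=> c; rewrite [c]row_cons lincomb_cons => /h[-> ->]; rewrite cons_row0.
Qed.

Lemma indepS V W n : indep V W n.+1 -> indep V W n.
Proof.
move=> [e Ve fe]; exists (fun i => e (lift ord0 i)) => // c Wc.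
have : cons_row 0 c = 0.
  apply: fe; rewrite /lincomb big_ord_recl mxE unlift_none /= scale0r add0r.
  by under eq_bigr do rewrite mxE liftK.
by move=> /rowP h; apply/rowP => i; have := h (lift ord0 i); rewrite !mxE liftK.
Qed.

Lemma indep_le V W m n : (m <= n)%N -> indep V W n -> indep V W m.
Proof.
move=> mn; rewrite -(subnK mn); elim: (n - m)%N => [//|k IH].
by rewrite addSn => /indepS/IH.
Qed.

Lemma indep_mono A B V W n : (forall x, A x -> V x) -> (forall x, A x -> W x -> B x) ->
  subsp A -> indep A B n -> indep V W n.
Proof.
move=> AV AWB sA [e Ae fe]; exists e => [i|c Wc]; first exact: AV.
by apply: fe; apply: AWB => //; apply: lincomb_in.
Qed.

(** Expressing the [n] vectors in the [m] spanning ones gives an [n] by [m] matrix,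
    which has a nonzero row in its kernel when [m < n]. *)
Lemma spans_indep V W m n (f : 'I_m -> X) : subsp W -> spans_mod V W f ->
  indep V W n -> (n <= m)%N.
Proof.
move=> sW sf [e Ve fe]; rewrite leqNgt; apply/negP => mn.
have [A AP] := choice (fun i => sf (e i) (Ve i)).
pose M := \matrix_(i < n, j < m) A i 0 j.
have : kermx M != 0.
  rewrite -mxrank_eq0 mxrank_ker subn_eq0 -ltnNge.
  exact: leq_ltn_trans (rank_leq_col M) mn.
move=> /rowV0Pn[c /sub_kermxP cM /eqP]; apply; apply: fe.
have -> : lincomb c e = \sum_i c 0 i *: (e i - lincomb (A i) f).
  under [RHS]eq_bigr do rewrite scalerBr; rewrite sumrB [X in _ - X](_ : _ = 0) ?subr0 //.
  have -> : \sum_i c 0 i *: lincomb (A i) f = lincomb (c *m M) f.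
    rewrite /lincomb; under eq_bigr do rewrite scaler_sumr.
    rewrite exchange_big; apply: eq_bigr => j _ /=; rewrite mxE scaler_suml.
    by apply: eq_bigr => i _; rewrite scalerA mxE.
  by rewrite cM lincomb0.
by apply: subsp_sum => // i; apply: subspZ.
Qed.

Lemma maximal_free_spans V W n (e : 'I_n -> X) : subsp W -> (forall i, V (e i)) ->
  free_mod W e -> ~ indep V W n.+1 -> spans_mod V W e.
Proof.
move=> sW Ve fe ni v Vv; apply: contrapT => ne; apply: ni.
apply: (indep_cons Vv Ve) => a c; have [->|a0] := eqVneq a 0.
  by rewrite scale0r add0r => /fe ->.
move=> Wc; exfalso; apply: ne; exists (- (a^-1 *: c)).
have := subspZ sW a^-1 Wc; rewrite scalerDr scalerA mulVf // scale1r.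
by rewrite lincombN opprK lincombZ.
Qed.

Lemma qdim_basis V W n (e : 'I_n -> X) : subsp W -> (forall i, V (e i)) ->
  free_mod W e -> spans_mod V W e -> qdim V W = (n%:Z)%:E.
Proof.
move=> sW Ve fe se; apply: natinf_eq.
  exists e; split => // x Vx; have [c Wc] := se x Vx; exists c; split => // d Wd.
  apply/eqP; rewrite -subr_eq0; apply/eqP/fe; rewrite lincombB.
  by have := subspB sW Wd Wc; rewrite -/(lincomb d e) -/(lincomb c e) opprB addrC addrA subrK.
move=> k [f [Vf fP]]; apply: (@spans_indep V W _ _ f) => //; last by exists e.
by move=> v /fP[c [Wc _]]; exists c.
Qed.

(** The two cases that reduce every dimension count to free families. *)
Lemma qdimP V W : subsp W ->
  (exists n, [/\ indep V W n, ~ indep V W n.+1 & qdim V W = (n%:Z)%:E]) \/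
  ((forall n, indep V W n) /\ qdim V W = +oo%E).
Proof.
move=> sW; have [all|] := pselect (forall n, indep V W n).
  right; split => //; apply: natinf_pinfty => n [e [Ve eP]].
  have /(spans_indep sW) : spans_mod V W e by move=> v /eP[c [Wc _]]; exists c.
  by move=> /(_ n.+1 (all _)); rewrite ltnn.
move=> /existsNP[m nm]; left.
have exP : exists n, `[< ~ indep V W n >] by exists m; apply/asboolP.
have [[|k] /asboolP nk kP] := ex_minnP exP; first by case: nk; apply: indep0.
have ik : indep V W k.
  by apply: contrapT => h; have := kP k; rewrite ltnn => /(_ (asboolT h)).
exists k; split => //; case: ik => e Ve fe.
by apply: (qdim_basis (e := e)) => //; apply: maximal_free_spans.
Qed.

Definition finmod V W := (qdim V W < +oo)%E.

Lemma finmodP V W : subsp W -> finmod V W <-> exists n, ~ indep V W n.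
Proof.
move=> sW; have [[n [i ni q]]|[all q]] := qdimP V sW; rewrite /finmod q; split => //.
- by exists n.+1.
- by move=> [n] [].
Qed.

Lemma spans_finmod V W n (e : 'I_n -> X) : subsp W -> spans_mod V W e -> finmod V W.
Proof.
move=> sW se; apply/finmodP => //; exists n.+1 => /(spans_indep sW se).
by rewrite ltnn.
Qed.

Lemma finmod_basis V W : subsp W -> finmod V W ->
  exists n (e : 'I_n -> X), [/\ forall i, V (e i), free_mod W e & spans_mod V W e].
Proof.
move=> sW; have [[n [[e Ve fe] ni _]]|[_ q]] := qdimP V sW; last by rewrite /finmod q.
by move=> _; exists n, e; split => //; apply: maximal_free_spans.
Qed.

(** [A / B] maps injectively to [V / W] when the part of [A] in [W] lies in [B]. *)
Lemma finmod_mono A B V W : (forall x, A x -> V x) -> (forall x, A x -> W x -> B x) ->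
  subsp A -> subsp B -> subsp W -> finmod V W -> finmod A B.
Proof.
move=> AV AWB sA sB sW /(finmodP _ sW)[n ni]; apply/finmodP => //; exists n.
by move=> /(indep_mono AV AWB sA).
Qed.

Lemma finmod_trans A B C : subsp A -> subsp B -> subsp C ->
  finmod A B -> finmod B C -> finmod A C.
Proof.
move=> sA sB sC /(finmod_basis sB)[m [f [Af _ sf]]] /(finmod_basis sC)[n [g [Bg _ sg]]].
pose h (i : 'I_(m + n)) := match fintype.split i with inl j => f j | inr j => g j end.
apply: (spans_finmod (e := h)) => // v Av.
have [c Bc] := sf v Av; have [d Cd] := sg _ Bc.
exists (row_mx c d); rewrite /lincomb big_split_ord /=.
rewrite (eq_bigr (fun i => c 0 i *: f i)); last first.
  by move=> i _; rewrite row_mxEl /h -[lshift n i]/(unsplit (inl i)) unsplitK.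
rewrite (eq_bigr (fun i => d 0 i *: g i) (r := index_enum 'I_n)); last first.
  by move=> i _; rewrite row_mxEr /h -[rshift m i]/(unsplit (inr i)) unsplitK.
by rewrite opprD addrA.
Qed.

Lemma eq_qdim V W A B : subsp W -> subsp B ->
  (forall n, indep V W n <-> indep A B n) -> qdim V W = qdim A B.
Proof.
move=> sW sB h.
have [[n [i ni ->]]|[all ->]] := qdimP V sW; have [[m [j nj ->]]|[all' ->]] := qdimP A sB => //.
- congr (_%:Z%:E); apply/eqP; rewrite eqn_leq; apply/andP; split; rewrite leqNgt; apply/negP => lt.
    by apply: nj; apply/h; apply: indep_le i.
  by apply: ni; apply/h; apply: indep_le j.
- by case: ni; apply/h.
- by case: nj; apply/h.
Qed.

(** The second isomorphism theorem: the hypotheses say that [V = A + W] and that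
    [B] and [W] meet [A] in the same subspace. *)
Lemma qdim_iso V W A B : subsp V -> subsp W -> subsp A -> subsp B ->
  (forall x, A x -> V x) -> (forall x, B x -> W x) ->
  (forall v, V v -> exists a w, [/\ A a, W w & v = a + w]) ->
  (forall a, A a -> W a -> B a) ->
  qdim V W = qdim A B.
Proof.
move=> sV sW sA sB AV BW dec AWB; apply: eq_qdim => // n; split; last exact: indep_mono.
move=> [e Ve fe].
have [f fP] := choice (fun i => dec (e i) (Ve i)).
exists f => [i|c Bc]; first by have [w []] := fP i.
apply: fe; have -> : lincomb c e = lincomb c f + lincomb c (fun i => e i - f i).
  by rewrite -big_split; apply: eq_bigr => i _; rewrite /= -scalerDr addrC subrK.
apply: subspD; [by []|exact: BW|apply: lincomb_in => // i].
by have [w [_ Ww ->]] := fP i; rewrite addrAC subrr add0r.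
Qed.

(** The same with one more dimension, spanned by [x]. *)
Lemma qdim_iso_line V W A B x : subsp V -> subsp W -> subsp A -> subsp B ->
  V x -> (forall x, A x -> V x) -> (forall x, B x -> W x) ->
  (forall v, V v -> exists a c w, [/\ A a, W w & v = a + c *: x + w]) ->
  (forall a c, A a -> W (a + c *: x) -> c = 0 /\ B a) ->
  qdim V W = (qdim A B + 1)%E.
Proof.
move=> sV sW sA sB Vx AV BW dec AWB.
have [[n [[f Af ff] nj ->]]|[all' ->]] := qdimP A sB.
  rewrite (qdim_basis (e := cons_fam x f)) //.
  - by rewrite -EFinD -PoszD addn1.
  - by apply: cons_fam_in => // i; apply: AV.
  - move=> c; rewrite [c]row_cons lincomb_cons addrC => /AWB[|-> /ff ->].
      exact: lincomb_in.
    by rewrite cons_row0.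
  - move=> v /dec[a [c [w [Aa Ww ->]]]].
    have [d Bd] := maximal_free_spans sB Af ff nj Aa.
    exists (cons_row c d); rewrite lincomb_cons.
    rewrite (_ : _ - _ = (a - lincomb d f) + w).
      by apply: subspD => //; apply: BW.
    by rewrite (addrAC a) addrKA addrAC.
have [[n [_ ni _]]|[_ ->]] := qdimP V sW => //.
case: ni; apply: (@indep_mono A B) => // a Aa Wa.
by have [] := AWB a 0 Aa; rewrite ?scale0r ?addr0.
Qed.

End Dimension.

(** * Bounded functionals *)
Section HahnBanach.
Context {R : realType} {X : completeNormedModType R[i]}.
Implicit Types (W : set X) (G : set (X * R)).

(** Partial functionals are graphs, ordered by inclusion, so that the union of a
    chain is again one; the bound by the norm makes them single-valued. *)
Definition real_graph G :=
  (forall t x a y b, G (x, a) -> G (y, b) -> G (x + t%:C *: y, a + t * b)) /\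
  (forall x a, G (x, a) -> a <= norm x).

Lemma real_graph0 G x a : real_graph G -> G (x, a) -> G (0, 0).
Proof. by move=> [lG _] Gx; have := lG (-1) _ _ _ _ Gx Gx; rewrite rmorphN1 scaleN1r subrr mulN1r subrr. Qed.

Lemma real_graphZ G t x a : real_graph G -> G (x, a) -> G (t%:C *: x, t * a).
Proof.
move=> rG Gx; have := rG.1 t _ _ _ _ (real_graph0 rG Gx) Gx.
by rewrite !add0r.
Qed.

(** The value [c] at [y] has to lie above all [a - norm (x - y)] and below all
    [norm (x + y) - a]; the triangle inequality leaves room for the supremum. *)
Lemma real_graph_extend G y : real_graph G -> G (0, 0) ->
  exists c, real_graph [set p | exists x a t, G (x, a) /\ p = (x + t%:C *: y, a + t * c)].
Proof.
move=> rG G0; have [lG bG] := rG.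
pose S : set R := [set s | exists x a, G (x, a) /\ s = a - norm (x - y)].
have ubS x a : G (x, a) -> ubound S (norm (x + y) - a).
  move=> Gx _ [x' [a' [Gx' ->]]]; have := lG 1 _ _ _ _ Gx Gx'.
  rewrite rmorph1 scale1r mul1r => /bG.
  have := normD (x + y) (x' - y); rewrite addrACA subrr addr0; lra.
have S0 : S !=set0 by exists (0 - norm (0 - y)), 0, 0.
have cub x a : G (x, a) -> sup S <= norm (x + y) - a.
  by move=> Gx; apply: ge_sup => //; apply: ubS.
have clb x a : G (x, a) -> a - norm (x - y) <= sup S.
  by move=> Gx; apply: ub_le_sup; [exists (norm (0 + y) - 0); exact: ubS | exists x, a].
exists (sup S); split.
  move=> t _ _ _ _ [x [a [s [Gx [-> ->]]]]] [x' [a' [s' [Gx' [-> ->]]]]].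
  exists (x + t%:C *: x'), (a + t * a'), (s + t * s'); split; first exact: lG.
  congr (_, _); last by ring.
  by rewrite scalerDr rmorphD rmorphM /= scalerDl scalerA addrACA.
move=> _ _ [x [a [t [Gx [-> ->]]]]].
have [t0|t0|->] := ltgtP t 0; last by rewrite rmorph0 scale0r mul0r !addr0; apply: bG.
- have s0 : 0 < - t by rewrite oppr_gt0.
  have := clb _ _ (real_graphZ (- t)^-1 rG Gx).
  have -> : ((- t)^-1)%:C *: x - y = ((- t)^-1)%:C *: (x + t%:C *: y).
    rewrite scalerDr scalerA -rmorphM invrN mulNr mulVf ?rmorphN1 ?scaleN1r //.
    exact: ltr0_neq0.
  rewrite normZ cabsR ?invr_ge0 ?(ltW s0) // -mulrBr mulrC ler_pdivrMr //.
  lra.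
- have := cub _ _ (real_graphZ t^-1 rG Gx).
  have -> : (t^-1)%:C *: x + y = (t^-1)%:C *: (x + t%:C *: y).
    by rewrite scalerDr scalerA -rmorphM mulVf ?rmorph1 ?scale1r // lt0r_neq0.
  rewrite normZ cabsR ?invr_ge0 ?(ltW t0) // -mulrBr mulrC ler_pdivlMr //.
  lra.
Qed.

(** A maximal graph above [G] is total, by [real_graph_extend]. The empty graph is
    included because it is the union of the empty chain. *)
Lemma real_graph_total G : real_graph G -> G (0, 0) ->
  exists2 A, real_graph A & G `<=` A /\ forall x, exists a, A (x, a).
Proof.
move=> rG G0.
pose P A := real_graph A /\ (A = set0 \/ G `<=` A).
have [A [[rA A0] maxA]] : exists A, P A /\ forall B, A `<` B -> ~ P B.
  apply: Zorn_bigcup => F FP tot; split.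
    split; last by move=> x a [A FA Axa]; apply: (FP A FA).1.2.
    move=> t x a y b [A FA Ax] [B FB By].
    have [AB|BA] := tot _ _ FA FB.
      by exists B => //; apply: (FP B FB).1.1 => //; apply: AB.
    by exists A => //; apply: (FP A FA).1.1 => //; apply: BA.
  have [[A [FA GA]]|nG] := pselect (exists A, F A /\ G `<=` A).
    by right=> p Gp; exists A => //; apply: GA.
  left; rewrite -subset0 => p [A FA Ap]; have [_ [A0|GA]] := FP A FA.
    by rewrite -A0.
  by case: nG; exists A.
have GA : G `<=` A.
  case: A0 => // A0; exfalso; apply: (maxA G); last by split => //; right.
  by rewrite A0; split => [|/(_ _ G0)].
exists A => //; split => // y; apply: contrapT => ny.
have [c rc] := real_graph_extend y rA (GA _ G0).
apply: (maxA _ _ (conj rc _)); last first.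
  by right=> -[x a] /GA Ax; exists x, a, 0; rewrite rmorph0 scale0r mul0r !addr0.
split=> [[x a] Ax|]; first by exists x, a, 0; rewrite rmorph0 scale0r mul0r !addr0.
move=> /(_ (y, c)) h; apply: ny; exists c; apply: h.
by exists 0, 0, 1; rewrite rmorph1 scale1r mul1r !add0r; split => //; apply: GA.
Qed.

Lemma real_functional G : real_graph G -> G (0, 0) ->
  exists g : X -> R, [/\ forall x t y, g (x + t%:C *: y) = g x + t * g y,
    forall x, `|g x| <= norm x & forall x a, G (x, a) -> g x = a].
Proof.
move=> rG G0; have [A [lA bA] [GA tA]] := real_graph_total rG G0.
have uniq x a b : A (x, a) -> A (x, b) -> a = b.
  move=> Aa Ab; have := lA (-1) _ _ _ _ Aa Ab; have := lA (-1) _ _ _ _ Ab Aa.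
  rewrite rmorphN1 scaleN1r subrr => /bA + /bA; rewrite norm0; lra.
have [g gP] := choice tA.
exists g; split.
- by move=> x t y; apply: (uniq (x + t%:C *: y)) => //; apply: lA.
- move=> x; rewrite ler_norml (bA _ _ (gP x)) andbT.
  have := lA (-1) _ _ _ _ (lA (-1) _ _ _ _ (gP x) (gP x)) (gP x).
  by rewrite rmorphN1 scaleN1r subrr add0r => /bA; rewrite normN; lra.
- by move=> x a /GA Ax; apply: (uniq x).
Qed.

Lemma closed_dist W v : closed W -> ~ W v ->
  exists2 d : R, 0 < d & forall w, W w -> d <= norm (v - w).
Proof.
move=> cW Wv; apply: contrapT => nd; apply: Wv; apply: closed_approx => // e e0.
apply: contrapT => nw; apply: nd; exists e => // w Ww.
by rewrite leNgt; apply/negP => ve; apply: nw; exists w.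
Qed.

Lemma cabs_le (a b : R) : cabs (a +i* b) <= `|a| + `|b|.
Proof.
rewrite [a +i* b]complexE; apply: le_trans (cabsD _ _) _; rewrite cabsM /=.
have cR (r : R) : cabs r%:C = `|r|.
  by rewrite /cabs normc_def /= expr0n addr0 sqrtr_sqr.
by rewrite !cR /cabs normc_def /= expr0n expr1n add0r sqrtr1 mul1r.
Qed.

Definition functional (f : X -> R[i]) :=
  (forall a x y, f (a *: x + y) = a * f x + f y) /\
  exists2 K : R, 0 <= K & forall x, cabs (f x) <= K * norm x.

Section Functional.
Context {f : X -> R[i]} (ff : functional f).

Lemma functional0 : f 0 = 0.
Proof.
by have := ff.1 (-1) 0 0; rewrite scaler0 addr0 mulN1r addNr.
Qed.

Lemma functionalD x y : f (x + y) = f x + f y.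
Proof. by have := ff.1 1 x y; rewrite scale1r mul1r. Qed.

Lemma functionalZ a x : f (a *: x) = a * f x.
Proof. by have := ff.1 a x 0; rewrite !addr0 functional0 addr0. Qed.

Lemma functionalB x y : f (x - y) = f x - f y.
Proof. by rewrite functionalD -scaleN1r functionalZ mulN1r. Qed.

Lemma functional_lincomb n (c : 'rV[R[i]]_n) e :
  f (lincomb c e) = \sum_i c 0 i * f (e i).
Proof.
rewrite /lincomb; elim/big_ind2: _ => [|x a y b <- <-|i _]; first exact: functional0.
  exact: functionalD.
exact: functionalZ.
Qed.

Lemma functional_kernel_closed (T : {linear X -> X}) :
  (exists2 L : R, 0 <= L & forall x, norm (T x) <= L * norm x) ->
  closed [set x | f (T x) = 0].
Proof.
move=> [L L0 bT]; have [K K0 bf] := ff.2.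
apply: approx_closed => x h /=; apply: cabs_eq0; apply/le_anti; rewrite cabs_ge0 andbT.
apply/ler_addgt0Pr => e e0; rewrite add0r.
have LK : 0 < K * L + 1 by rewrite ltr_wpDl ?mulr_ge0.
have [|y /= fy xy] := h (e / (K * L + 1)); first by rewrite divr_gt0.
rewrite -[f (T x)]subr0 -fy -functionalB -linearB; apply: le_trans (bf _) _.
apply: le_trans (ler_wpM2l K0 (bT _)) _; rewrite mulrA.
move: xy; rewrite ltr_pdivlMr // => /ltW; apply: le_trans; rewrite mulrC.
by rewrite ler_wpM2l ?norm_ge0 // lerDl.
Qed.

End Functional.

(** Extend the real functional [w + t v |-> t d] of [W + R v], where [d] bounds the
    distance of [v] to [W] from below. With [g] the extension,
    [g x - i g (i x)] is complex linear; it vanishes on [W] because [W] is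
    invariant under [i], and its value at [v] has real part [d]. *)
Lemma hahn_banach W v : subsp W -> closed W -> ~ W v ->
  exists f : X -> R[i], [/\ functional f, f v = 1 & forall w, W w -> f w = 0].
Proof.
move=> sW cW nWv; have [d d0 dP] := closed_dist cW nWv.
pose G : set (X * R) := [set p | exists w t, W w /\ p = (w + t%:C *: v, t * d)].
have rG : real_graph G.
  split.
    move=> t _ _ _ _ [w [s [Ww [-> ->]]]] [w' [s' [Ww' [-> ->]]]].
    exists (w + t%:C *: w'), (s + t * s'); split.
      by rewrite addrC; apply: sW.2.
    congr (_, _); last by ring.
    by rewrite scalerDr rmorphD rmorphM /= scalerDl scalerA addrACA.
  move=> _ _ [w [t [Ww [-> ->]]]].
  have [t0|t0] := lerP t 0.
    by apply: le_trans (norm_ge0 _); rewrite mulr_le0_ge0 // ltW.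
  have -> : w + t%:C *: v = t%:C *: (v - (- t^-1)%:C *: w).
    rewrite rmorphN scaleNr opprK scalerDr scalerA -rmorphM mulfV ?rmorph1 ?scale1r ?lt0r_neq0 //.
    by rewrite addrC.
  rewrite normZ cabsR ?(ltW t0) // ler_pM2l //; apply: dP; exact: subspZ.
have G0 : G (0, 0).
  by exists 0, 0; rewrite rmorph0 scale0r mul0r addr0; split => //; apply: subsp0.
have [g [gL gb gG]] := real_functional rG G0.
have g0 : g 0 = 0 by apply: gG.
have gD x y : g (x + y) = g x + g y.
  by have := gL x 1 y; rewrite rmorph1 scale1r mul1r.
have gZ t x : g (t%:C *: x) = t * g x by have := gL 0 t x; rewrite !add0r g0 add0r.
have gN x : g (- x) = - g x.
  by have := gZ (-1) x; rewrite rmorphN1 scaleN1r mulN1r.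
pose h x : R[i] := g x +i* - g ('i *: x).
have hD x y : h (x + y) = h x + h y.
  by rewrite /h scalerDr !gD opprD.
have hi x : h ('i *: x) = 'i * h x.
  rewrite /h scalerA -expr2 sqr_i scaleN1r gN opprK.
  by apply/eqP; rewrite eq_complex /=; apply/andP; split; apply/eqP; ring.
have hR t x : h (t%:C *: x) = t%:C * h x.
  rewrite /h scalerA mulrC -scalerA !gZ.
  by apply/eqP; rewrite eq_complex /=; apply/andP; split; apply/eqP; ring.
have hZ a x : h (a *: x) = a * h x.
  by rewrite [a]complexE scalerDl hD -scalerA hi !hR mulrDl mulrA.
have hv : h v != 0.
  rewrite eq_complex /= negb_and; apply/orP; left.
  rewrite (gG v d) ?lt0r_neq0 //.
  by exists 0, 1; rewrite rmorph1 scale1r mul1r add0r; split => //; apply: subsp0.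
have hb x : cabs (h x) <= 2 * norm x.
  apply: le_trans (cabs_le _ _) _; rewrite normrN.
  have := gb x; have := gb ('i *: x); rewrite normZ.
  have -> : cabs ('i : R[i]) = 1.
    by rewrite /cabs normc_def /= expr0n expr1n add0r sqrtr1.
  lra.
exists (fun x => (h v)^-1 * h x); split.
- split; first by move=> a x y; rewrite hD hZ mulrDr mulrCA.
  exists (cabs (h v)^-1 * 2); first by rewrite mulr_ge0 ?cabs_ge0.
  by move=> x; rewrite cabsM -mulrA ler_wpM2l ?cabs_ge0.
- by rewrite mulVf.
have gW w : W w -> g w = 0.
  move=> Ww; apply: gG; exists w, 0.
  by rewrite rmorph0 scale0r mul0r addr0.
move=> w Ww; have gi : g ('i *: w) = 0 by apply/gW/subspZ.
by rewrite /h gi (gW _ Ww) oppr0 mulr0.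
Qed.

End HahnBanach.

(** * Finite dimensional extensions of closed subspaces *)
Section FiniteExtensions.
Context {R : realType} {X : completeNormedModType R[i]}.
Implicit Types (V W Y : set X).

Lemma subsp_zero : subsp [set (0 : X)].
Proof. by split=> //= a x y -> ->; rewrite scaler0 addr0. Qed.

Lemma closed_zero : closed [set (0 : X)].
Proof.
apply: approx_closed => x h /=; apply: norm_eq0; apply/le_anti; rewrite norm_ge0 andbT.
by apply/ler_addgt0Pr => e /h[_ /= ->]; rewrite subr0 add0r => /ltW.
Qed.

Definition add_span W n (e : 'I_n -> X) : set X := [set x | exists c, W (x - lincomb c e)].

Lemma subsp_add_span W n (e : 'I_n -> X) : subsp W -> subsp (add_span W e).
Proof.
move=> sW; split; first by exists 0; rewrite lincomb0 subrr; apply: subsp0.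
move=> a x y [c Wc] [d Wd]; exists (a *: c + d).
rewrite lincombD lincombZ opprD addrACA -scalerBr; exact: sW.2.
Qed.

Lemma add_spanl W n (e : 'I_n -> X) x : W x -> add_span W e x.
Proof. by move=> Wx; exists 0; rewrite lincomb0 subr0. Qed.

Lemma add_spanr W n (e : 'I_n -> X) i : subsp W -> add_span W e (e i).
Proof.
move=> sW; exists (delta_mx 0 i); rewrite /lincomb (bigD1 i) //= mxE !eqxx scale1r big1.
  by rewrite addr0 subrr; apply: subsp0.
by move=> j ji; rewrite mxE eqxx (negbTE ji) scale0r.
Qed.

(** A functional that reads off the coordinate along [e] reduces convergence in
    [W + <e>] to convergence in [W]. *)
Lemma closed_add_line W e : subsp W -> closed W ->
  closed [set x | exists a, W (x - a *: e)].
Proof.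
move=> sW cW; have [We|nWe] := pselect (W e).
  rewrite (_ : [set x | _] = W) //; apply/seteqP; split => x /=.
    by move=> [a Wa]; rewrite -[x](subrK (a *: e)); apply: subspD => //; apply: subspZ.
  by move=> Wx; exists 0; rewrite scale0r subr0.
have [f [ff fe fW]] := hahn_banach sW cW nWe; have [K K0 bf] := ff.2.
apply: approx_closed => x h /=; exists (f x); apply: closed_approx => // d d0.
have D0 : 0 < 1 + K * norm e by rewrite ltr_wpDr ?mulr_ge0 ?norm_ge0.
have [|y [a Wy] xy] := h (d / (1 + K * norm e)); first by rewrite divr_gt0.
exists (y - a *: e) => //.
have fy : f y = a.
  by have := fW _ Wy; rewrite (functionalB ff) (functionalZ ff) fe mulr1 => /eqP; rewrite subr_eq0 => /eqP.
have -> : x - f x *: e - (y - a *: e) = (x - y) - f (x - y) *: e.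
  by rewrite (functionalB ff) fy scalerBl !opprB addrACA [RHS]addrACA (addrC (- y)).
apply: le_lt_trans (normB _ _) _; rewrite normZ.
move: xy; rewrite ltr_pdivlMr //; apply: le_lt_trans.
rewrite mulrDr mulr1 lerD2l mulrA (mulrC (norm (x - y))).
by rewrite ler_wpM2r ?norm_ge0.
Qed.

Lemma closed_add_span W n (e : 'I_n -> X) : subsp W -> closed W -> closed (add_span W e).
Proof.
move=> sW cW; elim: n e => [|n IH] e.
  rewrite (_ : add_span W e = W) //; apply/seteqP; split => x.
    by move=> [c]; rewrite /lincomb big_ord0 subr0.
  exact: add_spanl.
have := closed_add_line (e := e ord0) (subsp_add_span (fun i => e (lift ord0 i)) sW) (IH _).
congr closed; apply/seteqP; split => x.
  move=> [a [c Wc]]; exists (cons_row a c); rewrite /lincomb big_ord_recl mxE unlift_none /= opprD addrA.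
  by under eq_bigr do rewrite mxE liftK.
move=> [c Wc]; exists (c 0 ord0), (\row_i c 0 (lift ord0 i)).
move: Wc; rewrite /lincomb big_ord_recl opprD addrA.
by under [in X in _ -> X]eq_bigr do rewrite mxE.
Qed.

Lemma finmod_closed V W : subsp V -> subsp W -> (forall x, W x -> V x) -> closed W ->
  finmod V W -> closed V.
Proof.
move=> sV sW WV cW /(finmod_basis sW)[n [e [Ve _ se]]].
rewrite (_ : V = add_span W e); first exact: closed_add_span.
apply/seteqP; split => x; first by move=> /se.
move=> [c Wc]; rewrite -[x](subrK (lincomb c e)); apply: subspD => //; first exact: WV.
exact: lincomb_in.
Qed.

Lemma findim_closed V : subsp V -> finmod V [set 0] -> closed V.
Proof.
move=> sV; apply: finmod_closed => //; [exact: subsp_zero| |exact: closed_zero].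
by move=> _ ->; apply: subsp0.
Qed.

(** A nearest point need not exist, but one that is optimal up to the factor [r]
    does: this replaces distances to subspaces in what follows. *)
Lemma almost_best_approx Y x (r : R) : subsp Y -> closed Y -> 1 < r ->
  exists2 y, Y y & forall y', Y y' -> norm (x - y) <= r * norm (x - y').
Proof.
move=> sY cY r1; have [Yx|nYx] := pselect (Y x).
  by exists x => // y' _; rewrite subrr norm0 mulr_ge0 ?norm_ge0 //; lra.
have [d d0 dP] := closed_dist cY nYx.
pose S : set R := [set norm (x - y) | y in Y].
have S0 : S !=set0 by exists (norm (x - 0)), 0 => //; apply: subsp0.
have lbS : lbound S d by move=> _ [y Yy <-]; apply: dP.
have dS : d <= inf S by apply: lb_le_inf.
have e0 : 0 < (r - 1) * inf S by rewrite mulr_gt0 ?subr_gt0 // (lt_le_trans d0).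
have [_ [y Yy <-] yS] := inf_adherent e0 (conj S0 (ex_intro _ d lbS)).
exists y => // y' Yy'; have h : inf S <= norm (x - y').
  by apply: ge_inf; [exists d|exists y'].
have := ler_wpM2l (ltW (lt_trans ltr01 r1)) h; lra.
Qed.

(** Riesz's lemma, applied successively: each new unit vector is chosen at distance
    at least 1/2 of the span of [Y] and the previous ones. The bound on the
    coordinates depends only on the length of the family, which makes the steps of
    [disc_chain] uniform. *)
Lemma spread_family V Y n : subsp V -> subsp Y -> (forall y, Y y -> V y) -> closed Y ->
  indep V Y n ->
  exists e : 'I_n -> X, [/\ forall i, V (e i), forall i, norm (e i) = 1 &
    forall (c : 'rV_n) y, Y y -> forall i, cabs (c 0 i) <= 4 ^+ n * norm (lincomb c e + y)].
Proof.
move=> sV sY YV cY; elim: n => [_|n IH in1]; first by exists (fun=> 0); split => [[]|[]|c y _ []].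
have [e [Ve ne se]] := IH (indepS in1).
have sF := subsp_add_span e sY; have cF := closed_add_span (e := e) sY cY.
have [x [Vx Fx xP]] : exists x, [/\ V x, ~ add_span Y e x &
    forall y, add_span Y e y -> norm x <= 2 * norm (x - y)].
  have FV y : add_span Y e y -> V y.
    move=> [c Yc]; rewrite -[y](subrK (lincomb c e)).
    by apply: subspD => //; [exact: YV|exact: lincomb_in].
  suff [x0 Vx0 Fx0] : exists2 x, V x & ~ add_span Y e x.
    have [|f Ff fP] := almost_best_approx x0 sF cF (r := 2); first lra.
    exists (x0 - f); split; first by apply: subspB => //; apply: FV.
      by move=> h; apply: Fx0; rewrite -[x0](subrK f); apply: subspD.
    by move=> y Fy; rewrite -addrA -opprD; apply: fP; apply: subspD.
  apply: contrapT => nx.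
  have /(spans_indep sY)/(_ in1) : spans_mod V Y e.
    by move=> v Vv; apply: contrapT => h; apply: nx; exists v.
  by rewrite ltnn.
have x0 : x <> 0 by move=> x0; apply: Fx; rewrite x0; apply: subsp0.
have nx := norm_gt0 x0; pose t := (norm x)^-1; have t0 : 0 < t by rewrite invr_gt0.
exists (cons_fam (t%:C *: x) e); split.
- by apply: cons_fam_in => //; apply: subspZ.
- move=> i; rewrite /cons_fam; case: (unliftP ord0 i) => [j _|_] //=.
  by rewrite normZ cabsR ?(ltW t0) // mulVf // lt0r_neq0.
move=> c y Yy; rewrite [c]row_cons lincomb_cons; set a := c 0 ord0; set d := \row_i _.
set N := norm _.
have aN : cabs a <= 2 * N.
  have [->|/eqP a0] := eqVneq a 0; first by rewrite cabs0 mulr_ge0 ?norm_ge0.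
  have pa := cabs_gt0 a0; have tn0 : t%:C != 0 :> R[i].
    by rewrite -[0]/(0%:C) (inj_eq (@complexI R)) lt0r_neq0.
  pose s := a * t%:C; have s0 : s != 0 by rewrite mulf_neq0 //; apply/eqP.
  have := xP (- (s^-1 *: (lincomb d e + y))); rewrite opprK => /(_ _) H.
  have : norm x <= 2 * norm (x + s^-1 *: (lincomb d e + y)).
    apply: H; apply: subspN => //; apply: subspZ => //; exists d.
    by rewrite addrAC subrr add0r.
  have -> : x + s^-1 *: (lincomb d e + y) = s^-1 *: (a *: (t%:C *: x) + lincomb d e + y).
    by rewrite scalerA -/s -addrA [in RHS]scalerDr [in RHS]scalerA mulVf // scale1r.
  rewrite normZ -/N (_ : cabs s^-1 = norm x / cabs a); last first.
    by rewrite cabsV cabsM (cabsR (ltW t0)) invfM invrK mulrC.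
  move=> /(ler_wpM2r (ltW pa)).
  have -> : 2 * (norm x / cabs a * N) * cabs a = norm x * (2 * N).
    by field; apply: lt0r_neq0.
  by rewrite ler_pM2l.
have N0 : 0 <= N by apply: norm_ge0.
have dN i : cabs (d 0 i) <= 4 ^+ n * (3 * N).
  apply: le_trans (se d y Yy i) _; rewrite ler_wpM2l ?exprn_ge0 //.
  have := normB (a *: (t%:C *: x) + lincomb d e + y) (a *: (t%:C *: x)).
  rewrite -/N !normZ (cabsR (ltW t0)) mulVf ?lt0r_neq0 // mulr1.
  rewrite -(addrA (a *: _)) (addrC (a *: _)) addrK; lra.
have p1 : 1 <= (4 : R) ^+ n by apply: exprn_ege1; lra.
have p2 : N <= 4 ^+ n * N by rewrite ler_peMl.
move=> i; rewrite mxE; case: (unliftP ord0 i) => [j _|_] /=.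
  apply: le_trans (dN j) _; rewrite exprS; lra.
rewrite exprS; lra.
Qed.

End FiniteExtensions.

(** * Ranges and kernels along the powers of an operator *)
Section IterLinear.
Context {K : pzRingType} {X : lmodType K} (T : {linear X -> X}) (n : nat).

Fact iter_is_linear : linear (iter n T).
Proof. by move=> a x y; elim: n => //= k ->; rewrite linearP. Qed.

HB.instance Definition _ := GRing.isLinear.Build K X X *:%R (iter n T) iter_is_linear.

End IterLinear.

Section Ranges.
Context {R : realType} {X : completeNormedModType R[i]} (T : {linear X -> X}).
Implicit Types (V W : set X).

Definition stable V := forall x, V x -> V (T x).

Lemma iter_linear n a x y : iter n T (a *: x + y) = a *: iter n T x + iter n T y.
Proof. exact: (linearP (iter n T)). Qed.

Lemma iter_linear0 n : iter n T 0 = 0.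
Proof. exact: (linear0 (iter n T)). Qed.

Lemma iter_linearB n x y : iter n T (x - y) = iter n T x - iter n T y.
Proof. exact: (linearB (iter n T)). Qed.

Lemma iter_linearD n x y : iter n T (x + y) = iter n T x + iter n T y.
Proof. exact: (linearD (iter n T)). Qed.

Lemma subsp_ker V : subsp V -> subsp (ker T V).
Proof.
move=> sV; split; first by split; [exact: subsp0|exact: linear0].
by move=> a x y [Vx Tx] [Vy Ty]; split; [exact: sV.2|rewrite linearP Tx Ty scaler0 addr0].
Qed.

Lemma subsp_image V : subsp V -> subsp (T @` V).
Proof.
move=> sV; split; first by exists 0; [exact: subsp0|exact: linear0].
by move=> a _ _ [x Vx <-] [y Vy <-]; exists (a *: x + y); [exact: sV.2|exact: linearP].
Qed.

Lemma rgS V n : rg T V n.+1 = T @` rg T V n.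
Proof.
by apply/seteqP; split => [_ [x Vx <-]|_ [_ [x Vx <-] <-]]; [exists (iter n T x) => //; exists x|exists x].
Qed.

Lemma rg0 V : rg T V 0 = V.
Proof. by apply/seteqP; split => [_ [x Vx <-]|x Vx] //; exists x. Qed.

Lemma subsp_rg V n : subsp V -> subsp (rg T V n).
Proof.
move=> sV; elim: n => [|n IH]; first by rewrite rg0.
by rewrite rgS; apply: subsp_image.
Qed.

Lemma stable_iter V n x : stable V -> V x -> V (iter n T x).
Proof. by move=> iV Vx; elim: n => //= n; apply: iV. Qed.

Lemma rg_le V m n x : stable V -> (m <= n)%N -> rg T V n x -> rg T V m x.
Proof.
move=> iV mn [y Vy <-]; exists (iter (n - m) T y); first exact: stable_iter.
by rewrite -iterD subnKC.
Qed.

Lemma rg_sub V n x : stable V -> rg T V n x -> V x.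
Proof. by move=> iV [y Vy <-]; apply: stable_iter. Qed.

Lemma ker_rg_le V m n x : stable V -> (m <= n)%N -> ker T (rg T V n) x -> ker T (rg T V m) x.
Proof. by move=> iV mn [Rx Tx]; split => //; apply: rg_le mn Rx. Qed.

Definition fin_alpha V n := finmod (ker T (rg T V n)) [set 0].
Definition fin_beta V n := finmod (rg T V n) (rg T V n.+1).

Lemma fin_alphaE V n : fin_alpha V n = (alpha T (rg T V n) < +oo)%E.
Proof. by []. Qed.

Lemma fin_betaE V n : fin_beta V n = (beta T (rg T V n) < +oo)%E.
Proof. by rewrite /fin_beta /finmod rgS. Qed.

Section Invariant.
Context {V : set X} (sV : subsp V) (iV : stable V).
Local Notation Rn n := (rg T V n).
Local Notation Nn n := (ker T (rg T V n)).
Let sR n : subsp (Rn n) := subsp_rg n sV.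
Let sN n : subsp (Nn n) := subsp_ker (sR n).

Let lift_fam n k (e : 'I_k -> X) : (forall i, Rn n.+1 (e i)) ->
  {f : 'I_k -> X & forall i, Rn n (f i) /\ T (f i) = e i}.
Proof.
move=> Re; apply: (choice (P := fun i x => Rn n x /\ T x = e i)) => i.
by have := Re i; rewrite rgS => -[x Rx <-]; exists x.
Qed.

(** [N_n / N_(n+1)] embeds in [R(T^n) / R(T^(n+1))]. *)
Lemma fin_beta_ker n : fin_beta V n -> finmod (Nn n) (Nn n.+1).
Proof.
apply: finmod_mono; [by move=> x []| |exact: sN|exact: sN|exact: sR].
by move=> x [_ Tx] Rx.
Qed.

(** [T] induces a surjection of [R(T^n) / R(T^(n+1))] onto the next quotient,
    whose kernel is [N_n / N_(n+1)]. *)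
Lemma fin_beta_pred n : fin_beta V n.+1 -> finmod (Nn n) (Nn n.+1) -> fin_beta V n.
Proof.
move=> /(finmod_basis (sR _))[k [e [Re _ se]]] fN.
have [f fP] := lift_fam Re.
pose B : set X := [set x | exists v w, [/\ Nn n v, Rn n.+1 w & x = v + w]].
have NB x : Nn n x -> B x.
  by move=> Nx; exists x, 0; rewrite addr0; split => //; apply: subsp0.
have RB x : Rn n.+1 x -> B x.
  by move=> Rx; exists 0, x; rewrite add0r; split => //; apply: subsp0.
have sB : subsp B.
  split; first exact: NB (subsp0 (sN n)).
  move=> a _ _ [v [w [Nv Rw ->]]] [v' [w' [Nv' Rw' ->]]].
  exists (a *: v + v'), (a *: w + w'); split; [exact: (sN _).2|exact: (sR _).2|].
  by rewrite scalerDr addrACA.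
apply: (@finmod_trans _ _ (Rn n) B) => //.
  apply: (spans_finmod (e := f)) => // x Rx.
  have [|c Rc] := se (T x); first by rewrite rgS; exists x.
  exists c; move: Rc; rewrite rgS => -[w Rw Tw].
  exists (x - lincomb c f - w), w; split => //; last by rewrite subrK.
  split.
    apply: subspB => //; last exact: rg_le Rw.
    by apply: subspB => //; apply: lincomb_in => // i; have [] := fP i.
  rewrite !linearB linear_lincomb Tw.
  have -> : lincomb c (T \o f) = lincomb c e.
    by apply: eq_bigr => i _ /=; have [_ ->] := fP i.
  by rewrite subrr.
rewrite /finmod (@qdim_iso _ _ B (Rn n.+1) (Nn n) (Nn n.+1)) //.
- by move=> x [Rx _].
- by move=> x [_ Tx] Rx.
Qed.

Lemma fin_betaS n : fin_beta V n -> fin_beta V n.+1.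
Proof.
move=> /(finmod_basis (sR _))[k [e [Re _ se]]].
apply: (spans_finmod (e := T \o e)) => // x; rewrite rgS => -[y Ry <-].
have [c Rc] := se y Ry; exists c; rewrite -linear_lincomb -linearB rgS.
by exists (y - lincomb c e).
Qed.

Lemma fin_beta_le m n : (m <= n)%N -> fin_beta V m -> fin_beta V n.
Proof.
move=> mn; rewrite -(subnKC mn); elim: (n - m)%N => [|k IH]; first by rewrite addn0.
by rewrite addnS => /IH/fin_betaS.
Qed.

Lemma fin_alpha_le m n : (m <= n)%N -> fin_alpha V m -> fin_alpha V n.
Proof.
move=> mn; apply: finmod_mono => //; [|exact: subsp_zero|exact: subsp_zero].
by move=> x; apply: ker_rg_le.
Qed.

Lemma fin_ker m n : (m <= n)%N -> fin_alpha V m \/ fin_beta V m -> finmod (Nn m) (Nn n).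
Proof.
move=> mn [am|bm].
  apply: finmod_mono am => //; last exact: subsp_zero.
  by move=> x _ ->; apply: subsp0.
rewrite -(subnKC mn); elim: (n - m)%N => [|k IH].
  rewrite addn0; apply: (spans_finmod (n := 0) (e := fun=> 0)) => // v Nv.
  by exists 0; rewrite lincomb0 subr0.
apply: finmod_trans IH _ => //; rewrite addnS; apply: fin_beta_ker.
by apply: fin_beta_le bm; apply: leq_addr.
Qed.

Lemma fin_alpha_pred m n : (m <= n)%N -> fin_beta V m -> fin_alpha V n -> fin_alpha V m.
Proof.
move=> mn bm an; apply: finmod_trans an => //; first exact: subsp_zero.
by apply: fin_ker => //; right.
Qed.

Lemma fin_beta_pred_le m n : (m <= n)%N -> (forall j, (m <= j < n)%N -> finmod (Nn j) (Nn j.+1)) ->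
  fin_beta V n -> fin_beta V m.
Proof.
move=> mn; rewrite -(subnKC mn); elim: (n - m)%N => [|k IH] h; first by rewrite addn0.
rewrite addnS => /fin_beta_pred bn; apply: IH; last first.
  by apply: bn; apply: h; rewrite leq_addr addnS ltnSn.
by move=> j /andP[mj jk]; apply: h; rewrite mj addnS ltnS ltnW.
Qed.

(** Along the ranges, the dimension of [N_j] and that of [R(T^j) / R(T^(j+1))] do
    not increase, and decrease strictly when [N_j <> N_(j+1)]; one of the two is
    finite at [m]. Both are treated at once, [I j q] standing for the existence of
    a free family of length [q] at stage [j]. *)
Lemma kernel_stable m : fin_alpha V m \/ fin_beta V m ->
  exists d, forall r, (d <= r)%N -> Nn d = Nn r.
Proof.
move=> fm.
have [I [I0 IS Idrop [q nq]]] : exists I : nat -> nat -> Prop,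
    [/\ forall j, I j 0%N, forall j q, (m <= j)%N -> I j.+1 q -> I j q,
        forall j q, (m <= j)%N -> Nn j <> Nn j.+1 -> I j.+1 q -> I j q.+1 &
        exists q, ~ I m q].
  have pick j : Nn j <> Nn j.+1 -> exists2 x, Nn j x & ~ Rn j.+1 x.
    move=> ne; apply: contrapT => h; apply: ne; apply/seteqP; split => x; last exact: ker_rg_le.
    by move=> Nx; split; [apply: contrapT => nx; apply: h; exists x|case: Nx].
  case: fm => [/(finmodP _ subsp_zero)[q nq]|/(finmodP _ (sR _))[q nq]].
    exists (fun j q => indep (Nn j) [set 0] q); split; last by exists q.
    - by move=> j; apply: indep0.
    - move=> j k mj; apply: indep_mono => //; first by move=> x; apply: ker_rg_le.
    - move=> j k mj /pick[x Nx nRx] [e Ne fe]; apply: (indep_cons Nx (e := e)).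
        by move=> i; apply: ker_rg_le (Ne i).
      move=> a c; have [->|a0] := eqVneq a 0; first by rewrite scale0r add0r => /fe ->.
      move=> h; exfalso; apply: nRx.
      have : Nn j.+1 (- lincomb c e) by apply: subspN => //; apply: lincomb_in.
      move: h => /= /eqP; rewrite addr_eq0 => /eqP <- [h _].
      by have := subspZ (sR _) a^-1 h; rewrite scalerA mulVf // scale1r.
  exists (fun j q => indep (Rn j) (Rn j.+1) q); split; last by exists q.
  - by move=> j; apply: indep0.
  - move=> j k mj [e Re fe].
    have [f fP] := lift_fam Re.
    exists f => [i|c Rc]; first by have [] := fP i.
    apply: fe; have -> : lincomb c e = T (lincomb c f).
      by rewrite linear_lincomb; apply: eq_bigr => i _ /=; have [_ ->] := fP i.
    by rewrite rgS; exists (lincomb c f).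
  - move=> j k mj /pick[x [Rx Tx] nRx] [e Re fe].
    have [f fP] := lift_fam Re.
    apply: (indep_cons Rx (e := f)); first by move=> i; have [] := fP i.
    move=> a c Rac; have c0 : c = 0.
      apply: fe; have -> : lincomb c e = T (a *: x + lincomb c f).
        rewrite linearP Tx scaler0 add0r linear_lincomb.
        by apply: eq_bigr => i _ /=; have [_ ->] := fP i.
      by rewrite rgS; exists (a *: x + lincomb c f).
    split => //; apply/eqP; apply: contrapT => /negP a0; apply: nRx.
    have := subspZ (sR _) a^-1 Rac.
    by rewrite c0 lincomb0 addr0 scalerA mulVf // scale1r.
have Ile j r k : (m <= j)%N -> (j <= r)%N -> I r k -> I j k.
  move=> mj jr; rewrite -(subnKC jr); elim: (r - j)%N => [|i IH]; first by rewrite addn0.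
  by rewrite addnS => /IS h; apply: IH; apply: h; apply: leq_trans mj (leq_addr _ _).
have main : forall q j, (m <= j)%N -> ~ I j q -> exists d, forall r, (d <= r)%N -> Nn d = Nn r.
  elim=> [|k IH] j mj nI; first by case: nI.
  have [st|/existsNP[r /not_implyP[jr ne]]] := pselect (forall r, (j <= r)%N -> Nn j = Nn r).
    by exists j.
  have [i [ji nei]] : exists i, (j <= i)%N /\ Nn i <> Nn i.+1.
    apply: contrapT => h; apply: ne; rewrite -(subnKC jr).
    elim: (r - j)%N => [|l IHl]; first by rewrite addn0.
    rewrite addnS IHl; apply: contrapT => ne; apply: h; exists (j + l)%N.
    by split => //; apply: leq_addr.
  apply: (IH i.+1); first by rewrite leqW // (leq_trans mj).
  move=> Ii; apply: nI; apply: (Ile _ i) => //.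
  by apply: Idrop => //; apply: leq_trans mj ji.
exact: main (leqnn m) nq.
Qed.

End Invariant.
End Ranges.

(** * Semi-B-Fredholm operators: stable iteration and closed ranges *)
Section SumMap.
Context {K : pzRingType} {U : lmodType K} (T : {linear U -> U}).

Definition sum_map (p : U * U) : U := T p.1 + p.2.

Fact sum_map_is_linear : linear sum_map.
Proof. by move=> a p q; rewrite /sum_map /= linearP scalerDr addrACA. Qed.

HB.instance Definition _ :=
  GRing.isLinear.Build K (U * U)%type U *:%R sum_map sum_map_is_linear.

End SumMap.

Section SemiBFredholm.
Context {R : realType} {X : completeNormedModType R[i]} (T : {linear X -> X}).
Implicit Types (V W : set X).

(** For such an [m], [m_ T V] is [m], and so are the essential ascent and the
    essential descent when they are finite. *)
Definition least_fin V m := (fin_alpha T V m \/ fin_beta T V m) /\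
  forall j, fin_alpha T V j \/ fin_beta T V j -> (m <= j)%N.

Lemma m_fin V j :
  (mine (alpha T (rg T V j)) (beta T (rg T V j)) < +oo)%E <->
  fin_alpha T V j \/ fin_beta T V j.
Proof. by rewrite gt_min fin_alphaE fin_betaE; split=> /orP. Qed.

Lemma m_eq V m : least_fin V m -> m_ T V = (m%:Z)%:E.
Proof.
move=> [fm lm]; apply: natinf_eq; first exact/m_fin.
by move=> k /m_fin; apply: lm.
Qed.

Lemma ess_ascent_eq V m : least_fin V m -> fin_alpha T V m -> ess_ascent T V = (m%:Z)%:E.
Proof. by move=> [_ lm] am; apply: natinf_eq => // k ak; apply: lm; left. Qed.

Lemma ess_descent_eq V m : least_fin V m -> fin_beta T V m -> ess_descent T V = (m%:Z)%:E.
Proof.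
move=> [_ lm]; rewrite fin_betaE => bm; apply: natinf_eq => // k bk.
by apply: lm; right; rewrite fin_betaE.
Qed.

Lemma iter_bounded n : continuous T ->
  exists2 K : R, 0 <= K & forall x, norm (iter n T x) <= K * norm x.
Proof.
move=> cT; have [K K0 bK] := continuous_bounded cT; elim: n => [|n [L L0 bL]].
  by exists 1 => // x; rewrite mul1r.
exists (K * L); first exact: mulr_ge0.
move=> x /=; apply: le_trans (bK _) _; rewrite -mulrA ler_wpM2l //.
Qed.

Section Invariant.
Context {V : set X} (sV : subsp V) (iV : stable T V).
Local Notation Rn n := (rg T V n).
Local Notation Nn n := (ker T (rg T V n)).
Let sR n : subsp (Rn n) := subsp_rg T n sV.
Let sN n : subsp (Nn n) := subsp_ker T (sR n).

Lemma least_fin_exists j : fin_alpha T V j \/ fin_beta T V j ->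
  exists2 m, least_fin V m & (m <= j)%N.
Proof.
move=> fj; have [m [_ fm lm]] :=
  natinf_min (P := [set k | fin_alpha T V k \/ fin_beta T V k]) fj.
by exists m; [split|apply: lm].
Qed.

(** If only the cokernel were finite dimensional at the least index, the finite
    dimensional kernel met later would make the first one finite dimensional. *)
Lemma ess_ascent_least : (ess_ascent T V < +oo)%E ->
  exists2 m, least_fin V m & fin_alpha T V m.
Proof.
move=> /natinf_lty[a aa]; have [m lm ma] := least_fin_exists (or_introl aa).
exists m => //; have [[//|bm] _] := lm; exact: fin_alpha_pred ma bm aa.
Qed.

Lemma ess_descent_least : (ess_descent T V < +oo)%E ->
  exists2 m, least_fin V m & fin_beta T V m.
Proof.
move=> /natinf_lty[b /=]; rewrite -fin_betaE => bb.
have [m lm mb] := least_fin_exists (or_intror bb).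
exists m => //; have [[am|//] _] := lm; apply: fin_beta_pred_le mb _ bb => // j /andP[mj _].
by apply: fin_ker => //; left; apply: fin_alpha_le mj am.
Qed.

(** If the kernels were stable from some [d < m] on, the finiteness at [m] would go
    back to [d]. *)
Lemma least_fin_stable m d : least_fin V m ->
  (forall r, (d <= r)%N -> Nn d = Nn r) -> (m <= d)%N.
Proof.
move=> [fm lm] st; rewrite leqNgt; apply/negP => dm.
suff : fin_alpha T V d \/ fin_beta T V d by move=> /lm; rewrite leqNgt dm.
case: fm => [am|bm]; first by left; rewrite /fin_alpha (st m (ltnW dm)).
right; apply: fin_beta_pred_le (ltnW dm) _ bm => // j /andP[dj _].
rewrite -(st j dj) -(st j.+1 (leqW dj)).
apply: (spans_finmod (n := 0) (e := fun=> 0)) => // v Nv.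
by exists 0; rewrite lincomb0 subr0.
Qed.

Lemma dis_least m : least_fin V m ->
  exists d, [/\ dis T V = (d%:Z)%:E, (m <= d)%N, forall r, (d <= r)%N -> Nn d = Nn r &
    forall j, (j < d)%N -> exists2 r, (j <= r)%N & Nn j <> Nn r].
Proof.
move=> lm; have [d0 st0] := kernel_stable sV iV lm.1.
have [d [dE st dmin]] := natinf_min (P := [set m | forall r, (m <= r)%N -> Nn m = Nn r]) st0.
exists d; split => //; first exact: least_fin_stable.
move=> j jd; have : ~ (forall r, (j <= r)%N -> Nn j = Nn r).
  by move=> /dmin; rewrite leqNgt jd.
by move=> /existsNP[r /not_implyP[jr ne]]; exists r.
Qed.

Lemma dis_eq m : least_fin V m -> (forall r, (m <= r)%N -> Nn m = Nn r) ->
  dis T V = (m%:Z)%:E.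
Proof. by move=> lm st; apply: natinf_eq => // k stk; apply: least_fin_stable stk. Qed.

Context (cV : closed V) (cT : continuous T).

Let bT := continuous_bounded cT.
Let biter n := iter_bounded n cT.

(** If [z] is a limit of points of [R(T^a)], then [T z = T^(a+1) x]. Lifting
    through [T^(a+1)] shows that [z - T^a x] is a limit of points of [N_a], which is
    closed as it is finite dimensional. *)
Lemma closed_range_pred a : fin_alpha T V a -> closed (Rn a.+1) -> closed (Rn a).
Proof.
move=> aa cR; have [K K0 bK] := bT; have [L L0 bL] := biter a; have [M M0 bM] := biter a.+1.
have bV := closed_banach_set sV cV.
have [c c0 lift] : exists2 c, 0 <= c & forall x, V x -> exists x',
    [/\ V x', T (iter a T x') = T (iter a T x) & norm x' <= c * norm (T (iter a T x))].
  exact: (open_mapping (A := iter a.+1 T) bV M0 (fun x _ => bM x) cR).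
have cN : closed (Nn a) by apply: findim_closed.
apply: approx_closed => z hz.
have [x Vx Tz] : Rn a.+1 (T z).
  apply: closed_approx => // e e0; have K1 : 0 < K + 1 by rewrite ltr_wpDl.
  have [|y Ry zy] := hz (e / (K + 1)); first by rewrite divr_gt0.
  exists (T y); first by rewrite rgS; exists y.
  rewrite -linearB; apply: le_lt_trans (bK _) _.
  move: zy; rewrite ltr_pdivlMr // mulrC; apply: le_lt_trans.
  by rewrite ler_wpM2r ?norm_ge0 // lerDl.
suff Nz : Nn a (z - iter a T x).
  by rewrite -[z](subrK (iter a T x)); apply: subspD => //; [case: Nz|exists x].
apply: closed_approx => // e e0.
have D0 : 0 < 1 + L * (c * K) by rewrite ltr_wpDr // !mulr_ge0.
have [|_ [x' Vx' <-] zx'] := hz (e / (1 + L * (c * K))); first by rewrite divr_gt0.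
have [u [Vu Tu nu]] := lift (x - x') (subspB sV Vx Vx').
have TuE : T (iter a T (x - x')) = T (z - iter a T x').
  by rewrite iter_linearB !linearB -[T z]Tz.
exists (- iter a T (x - x' - u)).
  apply: subspN => //; split; first by exists (x - x' - u) => //; apply: subspB => //; apply: subspB.
  by rewrite iter_linearB linearB Tu subrr.
have -> : z - iter a T x - - iter a T (x - x' - u) = (z - iter a T x') - iter a T u.
  by rewrite opprK !iter_linearB !addrA subrK.
apply: le_lt_trans (normB _ _) _.
move: zx'; rewrite ltr_pdivlMr //; apply: le_lt_trans; rewrite mulrDr mulr1 lerD2l.
apply: le_trans (bL _) _; rewrite mulrCA ler_wpM2l //.
apply: le_trans nu _; rewrite TuE mulrCA ler_wpM2l // mulrC; exact: bK.
Qed.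

(** [R(T^n) + N_a] is closed, as a finite dimensional extension of a closed space,
    and [T] maps it onto [R(T^(n+1))]; it contains the kernel of [T] on [R(T^a)],
    so the open mapping theorem on [R(T^a)] gives a closed image. *)
Lemma closed_range_succ a n : (a <= n)%N -> fin_alpha T V a -> closed (Rn a) ->
  closed (Rn a.+1) -> closed (Rn n) -> closed (Rn n.+1).
Proof.
move=> an aa ca ca1 cn; have [K K0 bK] := bT.
have ba := closed_banach_set (sR a) ca; rewrite rgS in ca1.
have [c c0 lift] := open_mapping ba K0 (fun x _ => bK x) ca1.
pose S : set X := [set x | exists r k, [/\ Rn n r, Nn a k & x = r + k]].
have sS : subsp S.
  split; first by exists 0, 0; rewrite addr0; split => //; apply: subsp0.
  move=> b _ _ [v [w [Nv Rw ->]]] [v' [w' [Nv' Rw' ->]]].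
  exists (b *: v + v'), (b *: w + w'); split; [exact: (sR _).2|exact: (sN _).2|].
  by rewrite scalerDr addrACA.
have RS x : Rn n x -> S x.
  by move=> Rx; exists x, 0; rewrite addr0; split => //; apply: subsp0.
have cS : closed S.
  apply: finmod_closed cn _ => //.
  have [k [e [_ _ se]]] := finmod_basis subsp_zero aa.
  apply: (spans_finmod (e := e)) => // _ [r [v [Rr Nv ->]]].
  by have [d /= /eqP] := se v Nv; rewrite subr_eq0 => /eqP {1}->; exists d; rewrite addrK.
apply: approx_closed => z hz.
have Rz : (T @` Rn a) z.
  apply: closed_approx => // e /hz[y Ry zy]; exists y => //.
  by move: Ry; rewrite -rgS; apply: rg_le.
case: Rz => v Rv Tv.
suff [r [k [Rr [_ Tk] vE]]] : S v.
  by rewrite rgS -Tv vE linearD Tk addr0; exists r.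
apply: closed_approx => // e e0; have C0 : 0 < c + 1 by rewrite ltr_wpDl.
have [|y] := hz (e / (c + 1)); first by rewrite divr_gt0.
rewrite rgS => -[w Rw <-] zw; have Rw' : Rn a w by apply: rg_le an Rw.
have [u [Ru Tu nu]] := lift (v - w) (subspB (sR _) Rv Rw').
exists (v - u).
  exists w, (v - u - w); split => //; last by rewrite [RHS]addrC subrK.
  split; first by apply: subspB => //; apply: subspB.
  by rewrite !linearB Tu linearB addrAC subrr.
rewrite subKr; apply: le_lt_trans nu _; rewrite linearB Tv.
move: zw; rewrite ltr_pdivlMr // mulrC; apply: le_lt_trans.
by rewrite ler_wpM2r ?norm_ge0 // lerDl.
Qed.

Lemma closed_ranges_alpha a n : (a <= n)%N -> fin_alpha T V a -> closed (Rn a.+1) ->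
  closed (Rn n).
Proof.
move=> an aa ca1; have ca := closed_range_pred aa ca1.
rewrite -(subnKC an); elim: (n - a)%N => [|k IH]; first by rewrite addn0.
by rewrite addnS; apply: (closed_range_succ (a := a)) => //; apply: leq_addr.
Qed.

(** With [F] a finite dimensional complement of the range, [(w, f) |-> T w + f] is
    onto [W], hence open, and restricting it to [f = 0] keeps a bound for
    preimages. *)
Lemma closed_image_finite_codim W : subsp W -> closed W -> stable T W ->
  finmod W (T @` W) -> closed (T @` W).
Proof.
move=> sW cW iW /(finmod_basis (subsp_image T sW))[k [e [We fe se]]].
have [K K0 bK] := bT.
pose F := add_span [set 0] e.
have sF : subsp F := subsp_add_span e subsp_zero.
have cF : closed F := closed_add_span (e := e) subsp_zero closed_zero.
have FE x : F x -> exists c, x = lincomb c e.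
  by move=> [c /= /eqP]; rewrite subr_eq0 => /eqP ->; exists c.
have bWF := prod_banach_set (closed_banach_set sW cW) (closed_banach_set sF cF).
have bA (p : X * X) : (W `*` F) p -> norm (sum_map T p) <= (K + 1) * Num.max (norm p.1) (norm p.2).
  move=> _; apply: le_trans (normD _ _) _; rewrite mulrDl mul1r; apply: lerD.
    by apply: le_trans (bK _) _; rewrite ler_wpM2l // le_max lexx.
  by rewrite le_max lexx orbT.
have imW : sum_map T @` (W `*` F) = W.
  apply/seteqP; split => [_ [p [Wp /FE[c p2]] <-]|w Ww].
    by rewrite /sum_map p2; apply: subspD => //; [exact: iW|exact: lincomb_in].
  have [c [x Wx Tx]] := se w Ww; exists (x, lincomb c e).
    by split => //=; exists c; rewrite /= subrr.
  by rewrite /sum_map /= Tx subrK.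
have K1 : 0 <= K + 1 by rewrite addr_ge0.
have [c c0 lift] : exists2 c, 0 <= c & forall x f, W x -> F f -> exists x' f',
    [/\ W x', F f', T x' + f' = T x + f & norm x' <= c * norm (T x + f)].
  have cim : closed (sum_map T @` (W `*` F)) by rewrite imW.
  have [c c0 lift] := open_mapping bWF K1 bA cim.
  exists c => // x f Wx Ff; have [[x' f'] [[Wx' Ff'] E np]] := lift (x, f) (conj Wx Ff).
  by exists x', f'; split => //; apply: le_trans np; rewrite le_max lexx.
apply: (closed_of_lifting (closed_banach_set sW cW) K0 (fun x _ => bK x) c0) => x Wx.
have [x' [f [Wx' /FE[d ->] TE nx']]] := lift x 0 Wx (subsp0 sF).
rewrite addr0 in TE nx'; exists x'; split => //; rewrite -TE (_ : d = 0) ?lincomb0 ?addr0 //.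
apply: fe; exists (x - x'); first exact: subspB.
by rewrite linearB -TE addrAC subrr add0r.
Qed.

Lemma stable_rg n : stable T (Rn n).
Proof. by move=> x Rx; apply: (rg_le iV (leqnSn n)); rewrite rgS; exists x. Qed.

Lemma closed_ranges_beta b n : (b <= n)%N -> fin_beta T V b -> closed (Rn b) ->
  closed (Rn n).
Proof.
move=> bn bb cb; rewrite -(subnKC bn); elim: (n - b)%N => [|k IH]; first by rewrite addn0.
rewrite addnS rgS; apply: closed_image_finite_codim => //; first exact: stable_rg.
by have := fin_beta_le sV (leq_addr k b) bb; rewrite /fin_beta rgS.
Qed.

Lemma semi_B_Fredholm_ranges : semi_B_Fredholm T V ->
  exists2 m, least_fin V m & forall n, (m <= n)%N -> closed (Rn n).
Proof.
case=> [[aa]|[bb]].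
  have [m lm am] := ess_ascent_least aa; rewrite (ess_ascent_eq lm am) /= => cR.
  by exists m => // n mn; apply: closed_ranges_alpha mn am cR.
have [m lm bm] := ess_descent_least bb; rewrite (ess_descent_eq lm bm) /= => cR.
by exists m => // n mn; apply: closed_ranges_beta mn bm cR.
Qed.

Lemma least_fin_semi_B_Fredholm m : least_fin V m ->
  (forall n, (m <= n)%N -> closed (Rn n)) -> semi_B_Fredholm T V.
Proof.
move=> lm cR; case: (lm.1) => [am|bm]; [left|right].
  by rewrite /upper_semi_B_Fredholm (ess_ascent_eq lm am); split; [rewrite ltry|apply: cR].
by rewrite /lower_semi_B_Fredholm (ess_descent_eq lm bm); split; [rewrite ltry|apply: cR].
Qed.

End Invariant.
End SemiBFredholm.

(** * Splitting off a Jordan block *)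
Section JordanBlock.
Context {R : realType} {X : completeNormedModType R[i]} (T : {linear X -> X}).
Context (cT : continuous T).
Implicit Types (V W M N : set X).

Section DirectSum.
Context {V M B : set X} (sV : subsp V) (sM : subsp M) (sB : subsp B).
Context (iM : stable T M) (iB : stable T B).
Context (MV : forall x, M x -> V x).
Context (dec : forall v, V v -> exists m b, [/\ M m, B b & v = m + b]).
Context (MB : forall x, M x -> B x -> x = 0).

Lemma rg_summand n x : rg T M n x <-> M x /\ rg T V n x.
Proof.
split=> [[m Mm <-]|[Mx [v Vv vx]]].
  by split; [exact: stable_iter|exists m => //; apply: MV].
have [m [b [Mm Bb vE]]] := dec Vv.
have b0 : iter n T b = 0.
  apply: MB; last exact: stable_iter.
  have -> : iter n T b = x - iter n T m by rewrite -vx vE iter_linearD addrAC subrr add0r.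
  by apply: subspB => //; apply: stable_iter.
by exists m => //; rewrite -vx vE iter_linearD b0 addr0.
Qed.

Lemma ker_summand n x : ker T (rg T M n) x <-> M x /\ ker T (rg T V n) x.
Proof. by rewrite /ker /= rg_summand; split=> [[[? ?] ?]|[? [? ?]]]. Qed.

End DirectSum.

Section Block.
Context {V : set X} (sV : subsp V) (iV : stable T V) (cV : closed V).
Variables (p : nat) (x : X) (f : X -> R[i]).
(* the conclusions of [block_exists] below *)
Hypotheses (Vx : V x) (xp : iter p.+1 T x = 0) (ff : functional f).
Hypotheses (fx : forall i, f (iter i T x) = (i == p)%:R).
Hypotheses (fV : forall v, V v -> f (iter p.+1 T v) = 0).

Definition block : set X := [set y | exists c : 'rV_p.+1, y = lincomb c (fun i => iter i T x)].

(** All [j] are allowed, which makes invariance immediate; the conditions for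
    [j > p] hold on all of [V]. *)
Definition block_compl : set X := [set v | V v /\ forall j, f (iter j T v) = 0].

Lemma iter_block_vector i : (p < i)%N -> iter i T x = 0.
Proof. by move=> pi; rewrite -(subnK pi) iterD xp iter_linear0. Qed.

Lemma functional_iter_high j v : (p < j)%N -> V v -> f (iter j T v) = 0.
Proof.
move=> pj Vv; rewrite -(subnKC pj) iterD; apply: fV; exact: stable_iter.
Qed.

Lemma functional_iter_lincomb j (c : 'rV_p.+1) :
  f (iter j T (lincomb c (fun i => iter i T x))) = \sum_i c 0 i * ((j + i)%N == p)%:R.
Proof.
rewrite (linear_lincomb (iter j T)) (functional_lincomb ff).
by apply: eq_bigr => i _; rewrite /= -iterD fx.
Qed.

Lemma subsp_block : subsp block.
Proof.
split; first by exists 0; rewrite lincomb0.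
move=> a _ _ [c ->] [d ->]; exists (a *: c + d).
by rewrite lincombD lincombZ.
Qed.

Lemma block_iter i : block (iter i T x).
Proof.
have [pi|ip] := ltnP p i; first by rewrite iter_block_vector //; apply: subsp0 subsp_block.
exists (delta_mx 0 (Ordinal (ip : (i < p.+1)%N))).
rewrite /lincomb (bigD1 (Ordinal (ip : (i < p.+1)%N))) //= mxE !eqxx scale1r big1 ?addr0 //.
by move=> j ji; rewrite mxE eqxx (negbTE ji) scale0r.
Qed.

Lemma block_stable : stable T block.
Proof.
move=> _ [c ->]; rewrite linear_lincomb; apply: lincomb_in; first exact: subsp_block.
by move=> i; apply: (block_iter i.+1).
Qed.

Lemma block_sub y : block y -> V y.
Proof. by move=> [c ->]; apply: lincomb_in => // i; apply: stable_iter. Qed.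

Lemma block_nilpotent y : block y -> iter p.+1 T y = 0.
Proof.
move=> [c ->]; rewrite (linear_lincomb (iter p.+1 T)) /lincomb big1 // => i _ /=.
by rewrite -iterS -iterD iter_block_vector ?scaler0 // ltnS leq_addr.
Qed.

Lemma finmod_block : finmod block [set 0].
Proof.
apply: (spans_finmod (e := fun i : 'I_p.+1 => iter i T x)); first exact: subsp_zero.
by move=> _ [c ->]; exists c; rewrite /= subrr.
Qed.

Lemma subsp_block_compl : subsp block_compl.
Proof.
split; first by split=> [|j]; [exact: subsp0|rewrite iter_linear0 (functional0 ff)].
move=> a v w [Vv fv] [Vw fw]; split=> [|j]; first exact: sV.2.
by rewrite iter_linear ff.1 fv fw mulr0 addr0.
Qed.

Lemma block_compl_stable : stable T block_compl.
Proof. by move=> v [Vv fv]; split=> [|j]; [exact: iV|rewrite -iterSr]. Qed.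

Lemma closed_block_compl : closed block_compl.
Proof.
have -> : block_compl = V `&` \bigcap_(j in [set: nat]) [set v | f (iter j T v) = 0].
  by apply/seteqP; split => v [Vv h]; split => // j; [move=> _; exact: h|exact: h].
apply: closedI => //; apply: closed_bigI => j _.
apply: (functional_kernel_closed ff (T := iter j T)).
exact: iter_bounded.
Qed.

(** The coordinate of [v] on [T^i x] is [f (T^(p-i) v)], since [f (T^j x)] is 1 for
    [j = p] and 0 otherwise. *)
Lemma block_dec v : V v -> exists m b, [/\ block_compl m, block b & v = m + b].
Proof.
move=> Vv; pose c := \row_(i < p.+1) f (iter (p - i) T v).
exists (v - lincomb c (fun i => iter i T x)), (lincomb c (fun i => iter i T x)).
have Bc : block (lincomb c (fun i => iter i T x)) by exists c.
split => //; last by rewrite subrK.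
split=> [|j]; first by apply: subspB => //; apply: block_sub.
rewrite iter_linearB (functionalB ff) functional_iter_lincomb.
have [pj|jp] := ltnP p j.
  rewrite functional_iter_high // big1 ?subrr // => i _.
  by rewrite gtn_eqF ?mulr0 // ltn_addr.
have lt : (p - j < p.+1)%N by rewrite ltnS leq_subr.
rewrite (bigD1 (Ordinal lt)) //= mxE /= subKn // subnKC // eqxx mulr1 big1 ?addr0 ?subrr //.
move=> i /eqP ne; rewrite (_ : (j + i == p)%N = false) ?mulr0 //.
by apply/eqP => ji; apply: ne; apply: val_inj; apply: (@addnI j); rewrite /= ji subnKC.
Qed.

Lemma block_disjoint y : block_compl y -> block y -> y = 0.
Proof.
move=> [_ fy] [c yE]; rewrite yE (_ : c = 0) ?lincomb0 //; apply/rowP => i; rewrite mxE.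
have := fy (p - i)%N; rewrite yE functional_iter_lincomb (bigD1 i) //=.
rewrite subnK ?eqxx ?mulr1 -1?ltnS // big1 ?addr0 // => j /eqP ne.
rewrite (_ : (p - i + j == p)%N = false) ?mulr0 //; apply/eqP => h; apply: ne; apply: val_inj.
by apply/eqP; rewrite -(eqn_add2l (p - i)) h subnK // -ltnS.
Qed.

Let sM := subsp_block_compl.
Let sR n : subsp (rg T V n) := subsp_rg T n sV.
Let sRM n : subsp (rg T block_compl n) := subsp_rg T n sM.

Lemma rg_block_compl n y : rg T block_compl n y <-> block_compl y /\ rg T V n y.
Proof.
apply: (rg_summand sM block_compl_stable block_stable _ block_dec block_disjoint).
by move=> z [].
Qed.

Lemma ker_block_compl n y : ker T (rg T block_compl n) y <-> block_compl y /\ ker T (rg T V n) y.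
Proof.
apply: (ker_summand sM block_compl_stable block_stable _ block_dec block_disjoint).
by move=> z [].
Qed.

Lemma rg_block_high n : (p < n)%N -> rg T V n = rg T block_compl n.
Proof.
move=> pn; apply/seteqP; split=> y; last by move=> /rg_block_compl[].
move=> [v Vv <-]; have [m [b [Mm Bb ->]]] := block_dec Vv.
exists m => //; rewrite iter_linearD -[in X in _ = _ + X](subnK pn) iterD.
by rewrite (block_nilpotent Bb) iter_linear0 addr0.
Qed.

(** [T^p x] spans the kernel in the block; it lies in [R(T^n)] for [n <= p]. *)
Lemma alpha_block n :
  alpha T (rg T V n) = (alpha T (rg T block_compl n) + (n <= p)%:Z%:E)%E.
Proof.
have [np|pn] := leqP n p; last by rewrite rg_block_high // adde0.
apply: (@qdim_iso_line _ _ _ _ _ _ (iter p T x)).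
- exact: subsp_ker.
- exact: subsp_zero.
- exact: subsp_ker.
- exact: subsp_zero.
- split; last exact: xp.
  by exists (iter (p - n) T x); [exact: stable_iter|rewrite -iterD subnKC].
- by move=> y /ker_block_compl[].
- by [].
- move=> v [Rv Tv]; exists (v - f v *: iter p T x), (f v), 0; split => //; last by rewrite subrK addr0.
  have Nx : ker T (rg T V n) (iter p T x).
    split; last exact: xp.
    by exists (iter (p - n) T x); [exact: stable_iter|rewrite -iterD subnKC].
  have Nv : ker T (rg T V n) (v - f v *: iter p T x).
    have sN := subsp_ker T (sR n).
    by apply: subspB => //; apply: subspZ.
  apply/ker_block_compl; split => //; split; first by apply: rg_sub iV (proj1 Nv).
  case=> [|j]; last by rewrite iterSr (proj2 Nv) iter_linear0 (functional0 ff).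
  by rewrite (functionalB ff) (functionalZ ff) fx eqxx mulr1 subrr.
move=> a c /ker_block_compl[[_ fa] _] /= ac.
have c0 : c = 0.
  have := functional0 ff; rewrite -ac (functionalD ff) (functionalZ ff) fx eqxx mulr1.
  by rewrite (fa 0%N) add0r.
by split => //; move: ac; rewrite c0 scale0r addr0.
Qed.

(** [T^n x] spans the block's part of [R(T^n)] modulo [R(T^(n+1))], for [n <= p]. *)
Lemma beta_block n :
  beta T (rg T V n) = (beta T (rg T block_compl n) + (n <= p)%:Z%:E)%E.
Proof.
have [np|pn] := leqP n p; last by rewrite rg_block_high // adde0.
rewrite /beta -!rgS.
have Rx : rg T V n (iter n T x) by exists x.
have MR k y : rg T block_compl k y -> rg T V k y by move=> /rg_block_compl[].
apply: (@qdim_iso_line _ _ _ _ _ _ (iter n T x)) => //.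
- exact: MR.
- exact: MR.
- move=> _ [v Vv <-]; have [m [_ [Mm [c ->] ->]]] := block_dec Vv.
  exists (iter n T m), (c 0 ord0), (iter n.+1 T (lincomb (\row_(i < p) c 0 (lift ord0 i)) (fun i => iter i T x))).
  split.
  + by exists m.
  + exists (lincomb (\row_(i < p) c 0 (lift ord0 i)) (fun i => iter i T x)) => //.
    by apply: lincomb_in => // i; apply: stable_iter.
  rewrite iter_linearD -addrA; congr (_ + _); rewrite {1}/lincomb big_ord_recl iter_linearD.
  rewrite (_ : iter n T (c 0 ord0 *: _) = c 0 ord0 *: iter n T x); last first.
    by rewrite -[X in iter n T X]addr0 iter_linear iter_linear0 addr0.
  congr (_ + _); rewrite iterSr linear_lincomb; congr (iter n T _).
  by apply: eq_bigr => i _; rewrite mxE /=.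
move=> a c /rg_block_compl[Ma _] Rac; have fa := Ma.2.
have c0 : c = 0.
  case: (Rac) => w Vw wE.
  have : f (iter (p - n) T (a + c *: iter n T x)) = 0.
    by rewrite -wE -iterD addnS subnK //; apply: fV.
  rewrite iter_linearD -[c *: _]addr0 iter_linear iter_linear0 addr0.
  by rewrite (functionalD ff) (functionalZ ff) fa -iterD subnK // fx eqxx mulr1 add0r.
split => //; apply/rg_block_compl; split => //.
by move: Rac; rewrite c0 scale0r addr0.
Qed.

(** [T^p x] is independent of the kernel of the complement, modulo [R(T^d)], because
    [f] vanishes on both. *)
Lemma indep_block m d q : (m <= p < d)%N ->
  indep (ker T (rg T block_compl m)) (ker T (rg T block_compl d)) q ->
  indep (ker T (rg T V m)) (ker T (rg T V d)) q.+1.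
Proof.
move=> /andP[mp pd] [e Ne fe].
have sN := subsp_ker T (sRM m).
have Nx : ker T (rg T V m) (iter p T x).
  split; last exact: xp.
  by exists (iter (p - m) T x); [exact: stable_iter|rewrite -iterD subnKC].
apply: (indep_cons Nx (e := e)) => [i|a c [Rac Tac]].
  by have /ker_block_compl[] := Ne i.
have /ker_block_compl[Mc Nc] : ker T (rg T block_compl m) (lincomb c e) by apply: lincomb_in.
have a0 : a = 0.
  have : f (a *: iter p T x + lincomb c e) = 0.
    by case: Rac => w Vw <-; apply: functional_iter_high.
  rewrite (functionalD ff) (functionalZ ff) fx eqxx mulr1.
  by have := Mc.2 0%N => /= ->; rewrite addr0.
split => //; apply: fe; apply/ker_block_compl; split => //.
by move: Rac Tac; rewrite a0 scale0r add0r.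
Qed.

End Block.

(** For [y = T^p x] in the kernel but not in [R(T^(p+1))], the vectors
    [x, ..., T^p x] are free modulo [R(T^(p+1))], so the functional may be prescribed
    on all of them. *)
Lemma block_exists V p : subsp V -> stable T V -> closed (rg T V p.+1) ->
  ker T (rg T V p) <> ker T (rg T V p.+1) ->
  exists x f, [/\ V x, iter p.+1 T x = 0, functional f,
    forall i, f (iter i T x) = (i == p)%:R & forall v, V v -> f (iter p.+1 T v) = 0].
Proof.
move=> sV iV cR ne.
have [y [[x Vx xy] Ty] nRy] : exists2 y, ker T (rg T V p) y & ~ rg T V p.+1 y.
  apply: contrapT => h; apply: ne; apply/seteqP; split => x; last exact: ker_rg_le.
  by move=> Nx; split; [apply: contrapT => nx; apply: h; exists x|case: Nx].
have xp : iter p.+1 T x = 0 by rewrite iterS xy.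
have sR : subsp (rg T V p.+1) := subsp_rg T p.+1 sV.
pose e (i : 'I_p) := iter i T x; pose W := add_span (rg T V p.+1) e.
have nWy : ~ W y.
  move=> [c Rc].
  have cz n : forall i : 'I_p, (i < n)%N -> c 0 i = 0.
    elim: n => [//|n IH] i; rewrite ltnS leq_eqVlt => /orP[/eqP ni|]; last exact: IH.
    apply/eqP; apply: contrapT => /negP ci; apply: (nRy).
    have pi : (0 < p - i)%N by rewrite subn_gt0.
    (* [T^(p-i)] kills [y] and the terms above [i], and moves the term [i] to [y] *)
    have : rg T V p.+1 (iter (p - i) T (y - lincomb c e)).
      by apply: stable_iter Rc; apply: stable_rg.
    have -> : iter (p - i) T (y - lincomb c e) = (- c 0 i) *: y.
      rewrite iter_linearB -(subnKC pi) iterSr Ty iter_linear0 sub0r subnKC // scaleNr.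
      rewrite (linear_lincomb (iter (p - i) T)) /lincomb (bigD1 i) //= -iterD subnK 1?ltnW // xy.
      rewrite big1 ?addr0 // => j ji; have [jlt|ilt|/val_inj ij] := ltngtP j i.
      - by rewrite IH ?scale0r // -ni.
      - rewrite -iterD (iter_block_vector xp) ?scaler0 //.
        by rewrite -{1}(subnK (ltnW (ltn_ord i))) ltn_add2l.
      - by rewrite ij eqxx in ji.
    move=> /(subspZ sR (- c 0 i)^-1); rewrite scalerA mulVf ?scale1r //.
    by rewrite oppr_eq0.
  by apply: nRy; move: Rc; rewrite (_ : c = 0) ?lincomb0 ?subr0 //; apply/rowP => i; rewrite mxE (cz p).
have [f [ff fy fW]] := hahn_banach (subsp_add_span e sR) (closed_add_span (e := e) sR cR) nWy.
exists x, f; split => //; last by move=> v Vv; apply: fW; apply: add_spanl; exists v.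
move=> i; have [ip|pi|->] := ltngtP i p; last by rewrite xy.
- by apply: fW; apply: (add_spanr e (Ordinal ip) sR).
- by rewrite (iter_block_vector xp) // (functional0 ff).
Qed.

End JordanBlock.

(** * Removing the blocks *)
Section Reduction.
Context {R : realType} {X : completeNormedModType R[i]} (T : {linear X -> X}).
Context (cT : continuous T).
Implicit Types (M N : set X).

(** The invariant of the removal of blocks. The last clause records, for each [n],
    that the kernel and the cokernel of [T_[n]] lose the same finite dimension
    [q] when [X] is replaced by [M]. *)
Definition reduction d M N :=
  [/\ [/\ subsp M, closed M & stable T M],
      [/\ subsp N, stable T N, finmod N [set 0] & forall x, N x -> iter d T x = 0],
      forall x, M x -> N x -> x = 0,
      forall x, exists y z, [/\ M y, N z & x = y + z] &
      forall n, exists q : nat,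
        alpha T (rg T setT n) = (alpha T (rg T M n) + q%:Z%:E)%E /\
        beta T (rg T setT n) = (beta T (rg T M n) + q%:Z%:E)%E].

Lemma reduction_triv d : reduction d setT [set 0].
Proof.
split.
- by split; [split|exact: closedT|].
- split; [exact: subsp_zero|by move=> _ ->; rewrite linear0| |by move=> _ ->; rewrite iter_linear0].
  apply: (spans_finmod (n := 0) (e := fun=> 0)); first exact: subsp_zero.
  by move=> _ ->; exists 0; rewrite /= lincomb0 subrr.
- by move=> x _.
- by move=> x; exists x, 0; rewrite addr0.
- by move=> n; exists 0%N; rewrite !adde0.
Qed.

Lemma reduction_rg d M N n x : reduction d M N ->
  rg T M n x <-> M x /\ rg T setT n x.
Proof.
move=> [[sM _ iM] [sN iN _ _] MN dec _].
by apply: (rg_summand sM iM iN) => // v _; apply: dec.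
Qed.

Lemma reduction_ker d M N n x : reduction d M N ->
  ker T (rg T M n) x <-> M x /\ ker T (rg T setT n) x.
Proof.
by move=> rMN; rewrite /ker /= (reduction_rg _ _ rMN); split=> [[[? ?] ?]|[? [? ?]]].
Qed.

(** The block is split off inside [M] and its span joins [N]. The last clause makes
    the removal of blocks terminate. *)
Lemma remove_block d M N p : reduction d M N -> (p < d)%N -> closed (rg T M p.+1) ->
  ker T (rg T M p) <> ker T (rg T M p.+1) ->
  exists M' N', [/\ reduction d M' N', N `<=` N',
    exists2 x, N' x & iter p T x <> 0 &
    forall m q, (m <= p)%N -> indep (ker T (rg T M' m)) (ker T (rg T M' d)) q ->
      indep (ker T (rg T M m)) (ker T (rg T M d)) q.+1].
Proof.
move=> [[sM cM iM] [sN iN fN nN] MN dec idx] pd cR ne.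
have [x [f [Mx xp ff fx fM]]] := block_exists sM iM cR ne.
pose B := block T p x; pose M' := block_compl T f (V := M).
have sB : subsp B := subsp_block T p x.
have BM y : B y -> M y by apply: (block_sub sM iM Mx).
pose N' : set X := [set z | exists n b, [/\ N n, B b & z = n + b]].
have NN' : N `<=` N'.
  by move=> n Nn; exists n, 0; rewrite addr0; split => //; apply: subsp0.
have BN' : B `<=` N'.
  by move=> b Bb; exists 0, b; rewrite add0r; split => //; apply: subsp0.
exists M', N'; split => //.
- split.
  + split; [exact: subsp_block_compl|exact: closed_block_compl|exact: block_compl_stable].
  + have sN' : subsp N'.
      split; first by apply: NN'; apply: subsp0.
      move=> a _ _ [v [w [Nv Bw ->]]] [v' [w' [Nv' Bw' ->]]].
      exists (a *: v + v'), (a *: w + w'); split; [exact: sN.2|exact: sB.2|].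
      by rewrite scalerDr addrACA.
    split => //.
    * move=> _ [n [b [Nn Bb ->]]]; exists (T n), (T b); rewrite linearD; split => //.
        exact: iN.
      exact: (block_stable xp).
    * apply: (@finmod_trans _ _ N' B [set 0]) => //; [exact: subsp_zero| |exact: finmod_block].
      have [k [e [Ne _ se]]] := finmod_basis subsp_zero fN.
      apply: (spans_finmod (e := e)) => // _ [n [b [Nn Bb ->]]].
      by have [c /= /eqP] := se n Nn; rewrite subr_eq0 => /eqP {1}->; exists c; rewrite addrC addKr.
    * move=> _ [n [b [Nn Bb ->]]]; rewrite iter_linearD nN // add0r.
      by rewrite -(subnK pd) iterD (block_nilpotent xp Bb) iter_linear0.
  + move=> z M'z [n [b [Nn Bb zE]]].
    have n0 : n = 0.
      apply: MN => //; have -> : n = z - b by rewrite zE addrK.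
      by apply: subspB => //; [case: M'z|apply: BM].
    apply: (block_disjoint ff fx M'z); rewrite zE n0 add0r; exact: Bb.
  + move=> z; have [y [n [My Nn ->]]] := dec z.
    have [m [b [M'm Bb ->]]] := block_dec sM iM Mx ff fx fM My.
    by exists m, (n + b); split => //; [exists n, b|rewrite -addrA (addrC b)].
  + move=> n; have [q [-> ->]] := idx n.
    rewrite (alpha_block sM iM Mx xp ff fx fM) (beta_block sM iM Mx xp ff fx fM).
    by exists ((n <= p)%N + q)%N; rewrite -!addeA -EFinD -PoszD.
- exists x; first by apply: BN'; apply: (block_iter xp 0).
  by move=> xp0; have := fx p; rewrite xp0 (functional0 ff) eqxx => /eqP; rewrite eq_sym oner_eq0.
- by move=> m q mp; apply: (indep_block sM iM Mx xp ff fx fM); rewrite mp.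
Qed.

(** Induction on a bound [q] for the lengths of the free families of [N_m] modulo
    [N_d]: every block removed shortens them. *)
Lemma remove_blocks d m : (m <= d)%N -> (forall n, (m <= n)%N -> closed (rg T setT n)) ->
  forall q M N, reduction d M N ->
  ~ indep (ker T (rg T M m)) (ker T (rg T M d)) q ->
  exists M' N', [/\ reduction d M' N', N `<=` N' &
    ker T (rg T M' m) = ker T (rg T M' d)].
Proof.
move=> md cR; elim=> [|q IH] M N rMN nI; first by case: nI; apply: indep0.
have [E|ne] := pselect (ker T (rg T M m) = ker T (rg T M d)); first by exists M, N; split => //; apply: subset_refl.
have [p [mp pd nep]] : exists p, [/\ (m <= p)%N, (p < d)%N & ker T (rg T M p) <> ker T (rg T M p.+1)].
  apply: contrapT => h; apply: ne; rewrite -(subnKC md).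
  have : (m + (d - m) <= d)%N by rewrite subnKC.
  elim: (d - m)%N => [|k IHk]; first by rewrite addn0.
  rewrite addnS => kd; rewrite IHk ?(ltnW kd) //.
  apply: contrapT => ne; apply: h; exists (m + k)%N; split => //; exact: leq_addr.
have cRp : closed (rg T M p.+1).
  rewrite (_ : rg T M p.+1 = M `&` rg T setT p.+1).
    by apply: closedI; [have [[]] := rMN|apply: cR; apply: leqW].
  by apply/seteqP; split => x /(reduction_rg _ _ rMN).
have [M' [N' [rMN' NN' _ drop]]] := remove_block rMN pd cRp nep.
have [|M2 [N2 [r2 N2N' E]]] := IH M' N' rMN'.
  by move=> /(drop _ _ mp).
by exists M2, N2; split => //; apply: subset_trans N2N'.
Qed.

(** A block of size [d] is removed first, also when [d = m]: it is the one that gives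
    [T_N] the degree [d]. *)
Lemma reduction_exists m d : least_fin T setT m ->  (m <= d)%N ->
  (forall n, (m <= n)%N -> closed (rg T setT n)) ->
  (forall r, (d <= r)%N -> ker T (rg T setT d) = ker T (rg T setT r)) ->
  (forall j, (j < d)%N -> exists2 r, (j <= r)%N & ker T (rg T setT j) <> ker T (rg T setT r)) ->
  exists M N, [/\ reduction d M N, nilpotent_of_degree T N d &
    forall r, (m <= r)%N -> ker T (rg T M m) = ker T (rg T M r)].
Proof.
move=> lm md cR st jmp.
have sT : subsp (setT : set X) by split.
have iT : stable T setT by [].
have [M1 [N1 [r1 deg1]]] : exists M N, reduction d M N /\
    ((0 < d)%N -> exists2 x, N x & iter d.-1 T x <> 0).
  case: d md st jmp => [|p] md st jmp.
    by exists setT, [set 0]; split => //; apply: reduction_triv.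
  have [|r pr ne] := jmp p; first exact: ltnSn.
  have ne' : ker T (rg T setT p) <> ker T (rg T setT p.+1).
    move: pr; rewrite leq_eqVlt => /orP[/eqP pr|pr]; first by rewrite pr in ne.
    by rewrite (st r pr).
  have [M [N [rMN _ hx _]]] := remove_block (reduction_triv p.+1) (ltnSn p) (cR _ md) ne'.
  by exists M, N; split.
have fk : finmod (ker T (rg T M1 m)) (ker T (rg T M1 d)).
  have := fin_ker sT md lm.1; have [[sM _ _] _ _ _ _] := r1.
  apply: finmod_mono.
  - by move=> x /(reduction_ker _ _ r1)[].
  - by move=> x /(reduction_ker _ _ r1)[Mx _] Nx; apply/(reduction_ker _ _ r1).
  - exact/subsp_ker/subsp_rg.
  - exact/subsp_ker/subsp_rg.
  - exact/subsp_ker/subsp_rg.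
have [q nq] : exists q, ~ indep (ker T (rg T M1 m)) (ker T (rg T M1 d)) q.
  by apply/finmodP => //; have [[sM _ _] _ _ _ _] := r1; apply/subsp_ker/subsp_rg.
have [M [N [rMN N1N E]]] := remove_blocks md cR r1 nq.
have EM r : (d <= r)%N -> ker T (rg T M d) = ker T (rg T M r).
  move=> dr; apply/seteqP; split=> x /(reduction_ker _ _ rMN)[Mx Nx];
  by apply/(reduction_ker _ _ rMN); split => //; move: Nx; rewrite (st r dr).
exists M, N; split => //.
  have [_ [_ _ _ nN] _ _ _] := rMN; split => // k kN.
  case: d {fk nq md st jmp E rMN nN EM r1} deg1 => [//|p] deg1; have [//|x N1x px] := deg1.
  rewrite ltnNge; apply/negP => kp; apply: px => /=.
  by rewrite -(subnK kp) iterD kN ?iter_linear0 //; apply: N1N.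
move=> r mr; have [dr|rd] := leqP d r; first by rewrite E; apply: EM.
have [[sM _ iM] _ _ _ _] := rMN.
apply/seteqP; split=> x; last exact: ker_rg_le.
rewrite E; apply: ker_rg_le => //; exact: ltnW.
Qed.

End Reduction.

(** * Perturbation by scalars *)
Section PuncturedDisc.
Context {R : realType} {X : completeNormedModType R[i]}.
Implicit Types (V W : set X).

Lemma norm_lincomb n (c : 'rV[R[i]]_n) (e : 'I_n -> X) (B : R) :
  (forall i, norm (e i) <= B) -> norm (lincomb c e) <= B * \sum_i cabs (c 0 i).
Proof.
move=> eB; apply: le_trans (norm_sum _) _; rewrite mulr_sumr; apply: ler_sum => i _.
by rewrite normZ mulrC ler_wpM2r ?cabs_ge0.
Qed.

Lemma small_row_eq0 n (c : 'rV[R[i]]_n) (t : R) : n%:R * t < 1 ->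
  (forall i, cabs (c 0 i) <= t * \sum_j cabs (c 0 j)) -> c = 0.
Proof.
move=> nt h; set s := \sum_j cabs (c 0 j) in h.
have s0 : 0 <= s by apply: sumr_ge0 => j _; apply: cabs_ge0.
have sle : s <= n%:R * t * s.
  rewrite {1}/s; apply: le_trans (ler_sum _ (fun i _ => h i)) _.
  by rewrite sumr_const card_ord -mulrA mulr_natl.
have sz : s = 0.
  apply/le_anti; rewrite s0 andbT leNgt; apply/negP => sp.
  by move: sle; rewrite -{1}[s]mul1r ler_pM2r // leNgt nt.
apply/rowP => i; rewrite mxE; apply: cabs_eq0; apply/le_anti; rewrite cabs_ge0 andbT.
by have := h i; rewrite sz mulr0.
Qed.

Lemma half_step (a : R) : 0 <= a -> a * (2 * (a + 1))^-1 < 1.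
Proof.
by move=> a0; rewrite ltr_pdivrMr ?mul1r; [lra|rewrite mulr_gt0 // ltr_wpDl].
Qed.

Lemma slack (p : R) : 0 <= p -> p < 1 -> exists2 r, 1 < r & r * p < 1.
Proof.
move=> p0 p1; have q0 : 0 < 1 + p by lra.
exists (2 / (1 + p)); first by rewrite ltr_pdivlMr //; lra.
by rewrite mulrAC ltr_pdivrMr //; lra.
Qed.

(** The points [(j / n) mu] join 0 to [mu] inside the disc by steps of length at
    most [d]. *)
Lemma disc_chain (l : R) (P : R[i] -> Prop) : 0 <= l ->
  (exists2 d : R, 0 < d & forall mu nu, cabs mu <= l -> cabs nu <= l -> cabs (mu - nu) <= d ->
     P mu -> P nu) ->
  forall mu, cabs mu <= l -> P 0 <-> P mu.
Proof.
move=> l0 [d d0 step] mu mul.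
pose n := Num.bound (l / d).
have n0 : 0 < (n.+1%:R : R) by rewrite ltr0n.
have nl : l / n.+1%:R <= d.
  rewrite ler_pdivrMr // mulrC -ler_pdivrMr //.
  apply: le_trans (_ : n%:R <= _); last by rewrite ler_nat.
  by apply/ltW/archi_boundP; rewrite divr_ge0 // ltW.
pose z (j : nat) : R[i] := (j%:R / n.+1%:R : R)%:C * mu.
have zl j : (j <= n.+1)%N -> cabs (z j) <= l.
  move=> jn; rewrite cabsM cabsR ?divr_ge0 //; apply: le_trans mul.
  rewrite ler_piMl ?cabs_ge0 // ler_pdivrMr // mul1r ler_nat //.
have zd j : cabs (z j.+1 - z j) <= d.
  rewrite -mulrBl -rmorphB /= -mulrBl -natrB // subSnn cabsM cabsR ?divr_ge0 //.
  apply: le_trans nl; rewrite mul1r mulrC ler_wpM2r // invr_ge0 //; exact: ltW.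
have z0 : z 0%N = 0 by rewrite /z mul0r rmorph0 mul0r.
have zn : z n.+1 = mu by rewrite /z divff ?rmorph1 ?mul1r // lt0r_neq0.
have all j : (j <= n.+1)%N -> P 0 <-> P (z j).
  elim: j => [|j IH] jn; first by rewrite z0.
  rewrite IH ?(ltnW jn) //; have lj := zl j (ltnW jn); have lj1 := zl j.+1 jn.
  split; first by apply: step => //; rewrite -cabsN opprB.
  by apply: step.
by rewrite -zn; apply: all.
Qed.

Context (T : {linear X -> X}) (cT : continuous T).

Definition op_shift (mu : R[i]) (x : X) : X := T x - mu *: x.

Fact shift_is_linear mu : linear (op_shift mu).
Proof.
by move=> a x y; rewrite /op_shift linearP !scalerDr scalerN opprD addrACA !scalerA mulrC.
Qed.

HB.instance Definition _ mu := GRing.isLinear.Build R[i] X X *:%R (op_shift mu) (shift_is_linear mu).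

Lemma shift0 : op_shift 0 = T :> (X -> X).
Proof. by apply/funext => x; rewrite /op_shift scale0r subr0. Qed.

Lemma shift_shift mu nu x : op_shift mu x = op_shift nu x + (nu - mu) *: x.
Proof. by rewrite /op_shift scalerBl addrA subrK. Qed.

(** An eigenvector [x = mu^-1 T x] lies in the range of every power. *)
Lemma ker_shift_rg M n mu : subsp M -> stable T M -> mu != 0 ->
  ker (op_shift mu) M = ker (op_shift mu) (rg T M n).
Proof.
move=> sM iM mu0; apply/seteqP; split=> x [Vx Tx]; split => //; last exact: rg_sub iM Vx.
have xE : T x = mu *: x by apply/eqP; rewrite -subr_eq0 -[X in X == _]/(op_shift mu x) Tx.
elim: n => [|n IH]; first by rewrite rg0.
rewrite rgS; exists (mu^-1 *: x); first by apply: subspZ => //; apply: subsp_rg.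
by rewrite linearZ /= xE scalerA mulVf // scale1r.
Qed.

Lemma shift_stable M mu : subsp M -> stable T M -> forall x, M x -> M (op_shift mu x).
Proof. by move=> sM iM x Mx; apply: subspB => //; [exact: iM|exact: subspZ]. Qed.

Lemma subsp_shift M mu : subsp M -> subsp (op_shift mu @` M).
Proof. by move=> sM; apply: (subsp_image (op_shift mu)). Qed.

(** [T] is invertible modulo [T - mu], so that [T^n M + (T - mu) M = M]; and
    [x = mu^-1 (T x - a)] is as far in the ranges as [a] is. *)
Lemma beta_shift_rg M n mu : subsp M -> stable T M -> mu != 0 ->
  beta (op_shift mu) M = beta (op_shift mu) (rg T M n).
Proof.
move=> sM iM mu0; have sR := subsp_rg T n sM.
have iR k : stable T (rg T M k) by apply: stable_rg.
apply: qdim_iso => //; [exact: subsp_shift|exact: subsp_shift| | | |].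
- by move=> x; apply: rg_sub.
- by move=> _ [x Rx <-]; exists x => //; apply: rg_sub Rx.
- elim: n {sR} => [|n IH] v Mv.
    by exists v, 0; rewrite addr0 rg0; split => //; apply: subsp0; apply: subsp_shift.
  have [a [_ [Ra [y My <-] ->]]] := IH v Mv.
  exists (mu^-1 *: T a), (op_shift mu (y - mu^-1 *: a)); split.
  + by apply: subspZ; [exact: subsp_rg|rewrite rgS; exists a].
  + by exists (y - mu^-1 *: a) => //; apply: subspB => //; apply: subspZ => //; apply: rg_sub Ra.
  rewrite linearB /= linearZ /= {2}/op_shift scalerBr scalerA mulVf // scale1r.
  by rewrite opprB [RHS]addrCA (addrC (mu^-1 *: _)) subrK addrC.
- move=> a Ra [x Mx xa]; exists x => //.
  have {Ra} : forall k, (k <= n)%N -> rg T M k a by move=> k kn; apply: rg_le Ra.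
  elim: n {sR} => [|n IH] Ra; first by rewrite rg0.
  have Rx : rg T M n x by apply: IH => k kn; apply: Ra; apply: leqW.
  have -> : x = mu^-1 *: (T x - a).
    by rewrite -xa /op_shift subKr scalerA mulVf // scale1r.
  apply: subspZ; first exact: subsp_rg.
  by apply: subspB; [exact: subsp_rg|rewrite rgS; exists x|exact: Ra].
Qed.

(** The modulus is used through preimages: any [r < gamma] allows to solve
    [T x' = y] with [r * norm x' <= norm y]. *)
Lemma gamma_lifting V (r : R) : subsp V -> 0 < r -> (r%:E < gamma T V)%E ->
  forall x, V x -> exists x', [/\ V x', T x' = T x & norm x' <= r^-1 * norm (T x)].
Proof.
move=> sV r0 rg x Vx; have [Tx|/eqP Tx] := eqVneq (T x) 0.
  by exists 0; rewrite Tx linear0 !norm0 mulr0; split => //; apply: subsp0.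
have nT := norm_gt0 Tx.
pose S : set R := [set norm (x - y) | y in ker T V].
have S0 : S !=set0.
  by exists (norm (x - 0)), 0 => //; split; [exact: subsp0|rewrite linear0].
have lbS : lbound S 0 by move=> _ [y Yy <-]; apply: norm_ge0.
have : (gamma T V <= (norm (T x) / dist x (ker T V))%:E)%E.
  by apply: ereal_inf_lbound; exists x => //; split => // -[_ /Tx].
move=> /(lt_le_trans rg); rewrite lte_fin => h.
have d0 : 0 < dist x (ker T V).
  rewrite lt_neqAle lb_le_inf // andbT; apply/eqP => d0.
  by move: h; rewrite -d0 invr0 mulr0; lra.
rewrite ltr_pdivlMr // in h.
have e0 : 0 < r^-1 * norm (T x) - dist x (ker T V).
  by rewrite subr_gt0 ltr_pdivlMl.
have [_ [y [Vy Ty] <-]] := inf_adherent e0 (conj S0 (ex_intro _ 0 lbS)).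
rewrite (_ : inf S = dist x (ker T V)) // [X in _ < X]addrC subrK => xy.
by exists (x - y); split; [exact: subspB|rewrite linearB Ty subr0|exact: ltW].
Qed.

(** The bound for preimages given by the open mapping theorem bounds the distance to
    the kernel. *)
Lemma gamma_gt0 V : subsp V -> closed V -> closed (T @` V) -> (0 < gamma T V)%E.
Proof.
move=> sV cV cR; have [K K0 bK] := continuous_bounded cT.
have [c c0 lift] := open_mapping (closed_banach_set sV cV) K0 (fun x _ => bK x) cR.
have c1 : 0 < (c + 1)^-1 by rewrite invr_gt0 ltr_wpDl.
apply: lt_le_trans (_ : ((c + 1)^-1)%:E <= _)%E; first by rewrite lte_fin.
apply/ereal_infP => _ [x [Vx nKx] <-]; rewrite lee_fin.
have Tx : T x <> 0 by move=> Tx; apply: nKx.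
have [x' [Vx' Tx' nx']] := lift x Vx.
pose S : set R := [set norm (x - y) | y in ker T V].
have Kxx : ker T V (x - x') by split; [exact: subspB|rewrite linearB Tx' subrr].
have dle : dist x (ker T V) <= c * norm (T x).
  apply: le_trans nx'; apply: ge_inf; first by exists 0 => _ [y _ <-]; apply: norm_ge0.
  by exists (x - x') => //; rewrite subKr.
have nT := norm_gt0 Tx.
have d0 : 0 < dist x (ker T V).
  have [k k0 kx'] : exists2 k : R, 0 < k & forall y, ker T V y -> k <= norm (x - y).
    exists (norm (T x) / (K + 1)); first by rewrite divr_gt0 // ltr_wpDl.
    move=> y [Vy Ty]; rewrite ler_pdivrMr ?ltr_wpDl //.
    have := bK (x - y); rewrite linearB Ty subr0 => /le_trans; apply.
    by rewrite mulrC ler_wpM2l ?norm_ge0 // lerDl.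
  apply: lt_le_trans k0 _; apply: lb_le_inf; last by move=> _ [y Ky <-]; apply: kx'.
  by exists (norm (x - (x - x'))), (x - x').
rewrite ler_pdivlMr // mulrC ler_pdivrMr ?ltr_wpDl //.
by apply: le_trans dle _; rewrite mulrC ler_wpM2l ?norm_ge0 // lerDl.
Qed.

(** * Constancy of kernel and cokernel dimensions on the disc *)
Section Semiregular.
Context {V : set X} (sV : subsp V) (iV : stable T V) (cR : forall n, closed (rg T V n)).
Context (kR : forall n, ker T V = ker T (rg T V n)).
(* [c] is a lifting constant of [T] on [V] and [l] the radius of a disc *)
Variables (c l : R) (c0 : 0 < c) (l0 : 0 <= l) (cl : c * l < 1).
Hypothesis lift : forall x, V x ->
  exists x', [/\ V x', T x' = T x & norm x' <= c * norm (T x)].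

Let cV : closed V. Proof. by have := @cR 0%N; rewrite rg0. Qed.

Definition core : set X := [set x | forall n, rg T V n x].

Lemma subsp_core : subsp core.
Proof.
split=> [n|a x y Wx Wy n]; first exact: subsp0 (subsp_rg T n sV).
by apply: (subsp_rg T n sV).2.
Qed.

Lemma closed_core : closed core.
Proof.
rewrite (_ : core = \bigcap_(n in setT) rg T V n); first exact: closed_bigI.
by apply/seteqP; split => x h n; [move=> _; exact: h|exact: h].
Qed.

Lemma core_sub x : core x -> V x.
Proof. by move=> /(_ 0%N); rewrite rg0. Qed.

Lemma ker_core x : ker T V x -> core x.
Proof. by move=> Kx n; move: Kx; rewrite (@kR n) => -[]. Qed.

Lemma core_stable x : core x -> core (T x).
Proof. by move=> Wx n; apply: stable_rg. Qed.

(** Two preimages of a point differ by an element of the kernel, which is contained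
    in the core. *)
Lemma core_preimage x : V x -> core (T x) -> core x.
Proof.
move=> Vx WTx n; have := WTx n.+1; rewrite rgS => -[y Ry Ty].
rewrite -[x](subrK y); apply: subspD => //; first exact: subsp_rg.
apply: ker_core; split; last by rewrite linearB Ty subrr.
by apply: subspB => //; apply: rg_sub Ry.
Qed.

Lemma core_lift w : core w -> exists x, [/\ core x, T x = w & norm x <= c * norm w].
Proof.
move=> Ww; have := Ww 1%N; rewrite rgS rg0 => -[v Vv Tv].
have [x [Vx Tx nx]] := lift Vv; exists x; rewrite Tx -Tv; split => //.
by apply: core_preimage => //; rewrite Tx Tv.
Qed.

(** A Neumann series: lifting by [T] solves [(T - mu) x = w] up to [mu x]. *)
Lemma core_shift_lift : exists2 C : R, 0 <= C & forall mu, cabs mu <= l ->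
  forall w, core w -> exists x, [/\ core x, op_shift mu x = w & norm x <= C * norm w].
Proof.
have [K K0 bK] := continuous_bounded cT.
exists (c / (1 - c * l)); first by rewrite divr_ge0 ?subr_ge0 // ltW.
move=> mu mul w Ww.
have b : forall x, core x -> norm (op_shift mu x) <= (K + l) * norm x.
  move=> x _; apply: le_trans (normB _ _) _; rewrite mulrDl normZ; apply: lerD => //.
  by rewrite ler_wpM2r ?norm_ge0.
have Kl : 0 <= K + l by apply: addr_ge0.
apply: (approx_lifting (closed_banach_set subsp_core closed_core) Kl b (Y := core)) => //.
- exact: ltW.
- by rewrite mulr_ge0 // ltW.
move=> y Wy; have [x [Wx Tx nx]] := core_lift Wy; exists x.
have E : y - op_shift mu x = mu *: x by rewrite /op_shift Tx subKr.
rewrite E; split => //; first exact: (subspZ subsp_core).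
rewrite normZ (mulrC c) -mulrA; apply: ler_pM; rewrite ?cabs_ge0 ?norm_ge0 //.
Qed.

Lemma ker_shift_core mu x : ker (op_shift mu) V x -> core x.
Proof.
move=> Kx; have [m0|m0] := eqVneq mu 0.
  by apply: ker_core; move: Kx; rewrite m0 /ker /= /op_shift scale0r subr0.
by move=> n; move: Kx; rewrite (ker_shift_rg n sV iV m0) => -[].
Qed.

(** An eigenvector [e] for [mu] is corrected to [e - z] for [nu], where
    [(T - nu) z = (mu - nu) e] is solved in the core with [z] small. A spread family
    stays free under small corrections. *)
Lemma indep_ker_shift k mu : cabs mu <= l ->
  indep (ker T V) [set 0] k <-> indep (ker (op_shift mu) V) [set 0] k.
Proof.
move=> mul; have [C C0 lC] := core_shift_lift.
suff st : exists2 d : R, 0 < d & forall mu nu, cabs mu <= l -> cabs nu <= l ->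
    cabs (mu - nu) <= d ->
    indep (ker (op_shift mu) V) [set 0] k -> indep (ker (op_shift nu) V) [set 0] k.
  by have := disc_chain l0 st mul; rewrite shift0.
pose t : R := (2 * (k%:R * 4 ^+ k * C + 1))^-1.
exists t.
  by rewrite invr_gt0 mulr_gt0 // ltr_wpDl // !mulr_ge0 ?exprn_ge0.
move=> {mul}mu nu mul nul mn Ik.
have sK : subsp (ker (op_shift mu) V) := subsp_ker (op_shift mu) sV.
have [|e [Ke ne se]] := spread_family sK subsp_zero _ closed_zero Ik.
  by move=> _ ->; apply: subsp0.
have [z zP] : {z : 'I_k -> X & forall i, [/\ core (z i),
    op_shift nu (z i) = (mu - nu) *: e i & norm (z i) <= C * t]}.
  apply: (choice (P := fun i z => [/\ core z, op_shift nu z = (mu - nu) *: e i & norm z <= C * t])) => i.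
  have [|z [Wz zE nz]] := lC nu nul ((mu - nu) *: e i).
    exact: (subspZ subsp_core _ (ker_shift_core (Ke i))).
  exists z; split => //; apply: le_trans nz _; rewrite normZ ne mulr1.
  by rewrite ler_wpM2l.
exists (fun i => e i - z i).
  move=> i; have [Wz zE _] := zP i; have [Ve eE] := Ke i.
  split; first by apply: subspB => //; apply: core_sub.
  by rewrite linearB /= zE (shift_shift nu mu) eE add0r subrr.
move=> a /= ae; apply: (small_row_eq0 (t := 4 ^+ k * (C * t))).
  by rewrite !mulrA; apply: half_step; rewrite ?mulr_ge0 ?exprn_ge0.
move=> i; apply: le_trans (se a 0 erefl i) _; rewrite addr0 -mulrA ler_wpM2l ?exprn_ge0 //.
have -> : lincomb a e = lincomb a z.
  apply/eqP; rewrite -subr_eq0 -sumrB -[X in _ == X]ae; apply/eqP/eq_bigr => j _.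
  by rewrite scalerBr.
by apply: norm_lincomb => j; have [] := zP j.
Qed.

(** Modulo the core, [T] is bounded below by [1 / c], and subtracting [mu] costs at
    most [l < 1 / c]. The distance to the core is replaced by an almost optimal
    [w], whose factor [r] is close enough to 1 not to spoil this. *)
Lemma shift_bounded_below_mod_core : exists2 E : R, 0 <= E & forall mu, cabs mu <= l ->
  forall v, V v -> exists2 w, core w & norm (v - w) <= E * norm (op_shift mu v).
Proof.
have [r r1 rcl] := slack (mulr_ge0 (ltW c0) l0) cl.
have r0 : 0 <= r := ltW (lt_trans ltr01 r1).
exists (r * c / (1 - r * (c * l))).
  by rewrite divr_ge0 ?mulr_ge0 ?(ltW c0) // subr_ge0 ltW.
move=> mu mul v Vv.
have [w Ww wP] := almost_best_approx v subsp_core closed_core r1; exists w => //.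
have [u [Wu Tu _]] := core_lift (subspZ subsp_core mu Ww).
have [x [Vx Tx nx]] := lift (subspB sV Vv (core_sub Wu)).
have Wvx : core (v - x).
  have -> : v - x = (v - u - x) + u by rewrite [RHS]addrAC subrK.
  apply: (subspD subsp_core) => //; apply: ker_core.
  split; last by rewrite [LHS]linearB Tx subrr.
  by do 2?apply: subspB => //; apply: core_sub.
have := wP _ Wvx; rewrite subKr => le.
have TE : T (v - u) = op_shift mu v + mu *: (v - w).
  by rewrite linearB Tu /op_shift scalerBr addrA subrK.
rewrite TE in nx.
have le2 : norm (op_shift mu v + mu *: (v - w)) <= norm (op_shift mu v) + l * norm (v - w).
  by apply: le_trans (normD _ _) _; rewrite lerD2l normZ ler_wpM2r ?norm_ge0.
have d0 : 0 < 1 - r * (c * l) by rewrite subr_gt0.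
rewrite mulrAC ler_pdivlMr // mulrC.
have := ler_wpM2l r0 (le_trans nx (ler_wpM2l (ltW c0) le2)).
lra.
Qed.

(** The bound modulo the core, completed by a lift inside the core. *)
Lemma shift_lifting : exists2 D : R, 0 <= D & forall mu, cabs mu <= l ->
  forall v, V v -> exists v', [/\ V v', op_shift mu v' = op_shift mu v & norm v' <= D * norm (op_shift mu v)].
Proof.
have [E E0 bE] := shift_bounded_below_mod_core; have [C C0 lC] := core_shift_lift.
have [K K0 bK] := continuous_bounded cT.
exists (E + C * (1 + (K + l) * E)).
  by rewrite addr_ge0 // mulr_ge0 // addr_ge0 // mulr_ge0 // addr_ge0.
move=> mu mul v Vv; have [w Ww vw] := bE mu mul v Vv.
have Ws : core (op_shift mu w).
  by apply: (subspB subsp_core); [exact: core_stable|exact: (subspZ subsp_core)].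
have [w' [Ww' sw' nw']] := lC mu mul _ Ws.
exists (v - w + w'); split.
- by apply: subspD; [|apply: subspB => //|]; rewrite //; apply: core_sub.
- by rewrite linearD linearB /= sw' subrK.
apply: le_trans (normD _ _) _; rewrite mulrDl; apply: lerD => //.
apply: le_trans nw' _; rewrite -mulrA ler_wpM2l // mulrDl mul1r.
have -> : op_shift mu w = op_shift mu v - op_shift mu (v - w) by rewrite -linearB /= subKr.
apply: le_trans (normB _ _) _; rewrite lerD2l -mulrA.
apply: le_trans (_ : (K + l) * norm (v - w) <= _); last by rewrite ler_wpM2l // addr_ge0.
apply: le_trans (normB _ _) _; rewrite mulrDl normZ; apply: lerD => //.
by rewrite ler_wpM2r ?norm_ge0.
Qed.

Lemma closed_shift_image mu : cabs mu <= l -> closed (op_shift mu @` V).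
Proof.
move=> mul; have [D D0 lD] := shift_lifting; have [K K0 bK] := continuous_bounded cT.
apply: (closed_of_lifting (closed_banach_set sV cV) (K := K + l) _ _ D0 (lD mu mul)).
  exact: addr_ge0.
move=> x _; apply: le_trans (normB _ _) _; rewrite mulrDl normZ; apply: lerD => //.
by rewrite ler_wpM2r ?norm_ge0.
Qed.

(** If [sum a_i e_i = (T - nu) v], then [sum a_i e_i] is within [|mu - nu| |v - w|] of
    the range of [T - mu] for every [w] in the core, and [v - w] is bounded by the
    sum itself for a good [w]. For a spread family this forces the sum to vanish. *)
Lemma indep_coker_shift k mu : cabs mu <= l ->
  indep V (T @` V) k <-> indep V (op_shift mu @` V) k.
Proof.
move=> mul; have [C C0 lC] := core_shift_lift; have [E E0 bE] := shift_bounded_below_mod_core.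
suff st : exists2 d : R, 0 < d & forall mu nu, cabs mu <= l -> cabs nu <= l ->
    cabs (mu - nu) <= d ->
    indep V (op_shift mu @` V) k -> indep V (op_shift nu @` V) k.
  by have := disc_chain l0 st mul; rewrite shift0.
pose t : R := (2 * (k%:R * 4 ^+ k * E + 1))^-1.
exists t.
  by rewrite invr_gt0 mulr_gt0 // ltr_wpDl // !mulr_ge0 ?exprn_ge0.
move=> {mul}mu nu mul nul mn Ik.
have sY : subsp (op_shift mu @` V) := subsp_shift mu sV.
have [|e [Ve ne se]] := spread_family sV sY _ (closed_shift_image mul) Ik.
  by move=> _ [v Vv <-]; apply: shift_stable.
exists e => // a [v Vv va]; apply: (small_row_eq0 (t := 4 ^+ k * (E * t))).
  by rewrite !mulrA; apply: half_step; rewrite ?mulr_ge0 ?exprn_ge0.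
have [w Ww vw] := bE nu nul v Vv.
have Ws : core (op_shift nu w).
  by apply: (subspB subsp_core); [exact: core_stable|exact: (subspZ subsp_core)].
have [w' [Ww' sw' _]] := lC mu mul _ Ws.
move=> i; have Yy : (op_shift mu @` V) (- op_shift mu (w' + (v - w))).
  exists (- (w' + (v - w))); last by rewrite linearN.
  by apply: subspN => //; apply: subspD => //; [exact: core_sub|apply: subspB => //; exact: core_sub].
apply: le_trans (se a _ Yy i) _; rewrite -mulrA ler_wpM2l ?exprn_ge0 //.
have -> : lincomb a e - op_shift mu (w' + (v - w)) = (mu - nu) *: (v - w).
  have -> : op_shift mu (w' + (v - w)) = op_shift mu w' + op_shift mu (v - w) := linearD _ _ _.
  have wE : op_shift nu (v - w) = op_shift nu v - op_shift nu w := linearB _ _ _.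
  rewrite sw' -va (shift_shift mu nu (v - w)) wE.
  rewrite addrA (addrC (op_shift nu w)) subrK opprD addrA subrr add0r.
  by rewrite -scaleNr opprB.
rewrite normZ mulrC.
apply: le_trans (ler_pM (norm_ge0 _) (cabs_ge0 _) vw mn) _.
have t0 : 0 <= t by rewrite invr_ge0 mulr_ge0 // addr_ge0 // !mulr_ge0 ?exprn_ge0.
rewrite mulrAC ler_wpM2l ?mulr_ge0 //.
rewrite va -[leRHS]mul1r; apply: norm_lincomb => j; by rewrite ne.
Qed.

End Semiregular.

End PuncturedDisc.

(** * The jump and the decomposition *)
Section Jump.
Context {R : realType} {X : completeNormedModType R[i]} (T : {linear X -> X}).
Context (cT : continuous T).

Lemma rg_rg M m n : rg T (rg T M m) n = rg T M (n + m).
Proof.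
elim: n => [|n IH]; first by rewrite rg0.
by rewrite addSn !rgS IH.
Qed.

Lemma ereal_between (a : R) (g : \bar R) : (a%:E < g)%E ->
  exists2 r : R, a < r & (r%:E < g)%E.
Proof.
case: g => [g||//]; last by move=> _; exists (a + 1); rewrite ?ltry //; lra.
by rewrite lte_fin => ag; exists ((a + g) / 2); rewrite ?lte_fin; lra.
Qed.

Lemma least_fin_uniq M m n : least_fin T M m -> least_fin T M n -> m = n.
Proof.
move=> [fm lm] [fn ln]; apply/eqP; rewrite eqn_leq lm //; exact: ln.
Qed.

Lemma finite_subee (V W : set X) : subsp W -> finmod V W -> (qdim V W - qdim V W = 0)%E.
Proof.
move=> sW; rewrite /finmod; have [[n [_ _ ->]]|[_ ->]] := qdimP V sW => // _.
by rewrite -EFinB subrr.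
Qed.

(** The disc of radius [gamma] is reached through some [r] between the modulus of
    [lambda] and [gamma]: on [V = R(T^m)], [1 / r] is a lifting constant. *)
Lemma has_jump0 M m : subsp M -> stable T M -> closed M -> least_fin T M m ->
  (forall n, (m <= n)%N -> closed (rg T M n)) ->
  (forall r, (m <= r)%N -> ker T (rg T M m) = ker T (rg T M r)) ->
  has_jump T M 0%E.
Proof.
move=> sM iM cM lm cR st; rewrite /has_jump (m_eq lm) (dis_eq sM iM lm st) /=.
set V := rg T M m; have sV : subsp V := subsp_rg T m sM.
have iV : stable T V := stable_rg iM (n := m).
have cV : closed V by apply: cR.
have g0 : (0 < gamma T V)%E.
  by apply: gamma_gt0 => //; rewrite /V -rgS; apply: cR.
split=> //; first exact: least_fin_semi_B_Fredholm lm cR.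
move=> lambda; rewrite cabsE ltcR => l0 /ereal_between[r lr rgam].
have lam0 : lambda != 0 by apply/eqP => h; move: l0; rewrite h cabs0 ltxx.
have r0 : 0 < r by apply: lt_trans l0 _.
have cl : r^-1 * cabs lambda < 1 by rewrite mulrC ltr_pdivrMr // mul1r.
have cRV n : closed (rg T V n) by rewrite rg_rg; apply: cR; apply: leq_addl.
have kV n : ker T V = ker T (rg T V n) by rewrite rg_rg; apply: st; apply: leq_addl.
have lift := gamma_lifting sV r0 rgam.
have c0 : 0 < r^-1 by rewrite invr_gt0.
split=> [[aa _]|[bb _]].
  have [m' lm' am] := ess_ascent_least sM aa.
  rewrite -(least_fin_uniq lm lm') in am.
  rewrite -[fun x => _]/(op_shift T lambda) [X in (_ - X)%E](_ : _ = alpha T V).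
    by apply: finite_subee => //; apply: subsp_zero.
  rewrite /alpha (ker_shift_rg m sM iM lam0); apply: eq_qdim; [exact: subsp_zero|exact: subsp_zero|].
  move=> k; apply: iff_sym.
  exact: (indep_ker_shift cT sV iV cRV kV c0 (ltW l0) cl lift).
have [m' lm' bm] := ess_descent_least sM iM bb.
rewrite -(least_fin_uniq lm lm') fin_betaE in bm.
rewrite -[fun x => _]/(op_shift T lambda) [X in (_ - X)%E](_ : _ = beta T V).
  by apply: finite_subee => //; apply: subsp_image.
rewrite (beta_shift_rg m sM iM lam0); apply: eq_qdim; [exact: subsp_shift|exact: subsp_image|].
move=> k; apply: iff_sym.
exact: (indep_coker_shift cT sV iV cRV kV c0 (ltW l0) cl lift).
Qed.

Lemma reduction_fin d M N n : reduction T d M N ->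
  fin_alpha T M n \/ fin_beta T M n <-> fin_alpha T setT n \/ fin_beta T setT n.
Proof.
move=> [_ _ _ _ /(_ n)[q [aE bE]]]; rewrite !fin_alphaE !fin_betaE aE bE.
have h (x : \bar int) : (x + q%:Z%:E < +oo)%E = (x < +oo)%E.
  by case: x => [r||] //; rewrite -EFinD !ltry.
by rewrite !h.
Qed.

Lemma reduction_ind d M N m : reduction T d M N -> least_fin T setT m ->
  least_fin T M m -> ind T setT = ind T M.
Proof.
move=> [_ _ _ _ /(_ m)[q [aE bE]]] lm lM; rewrite /ind (m_eq lm) (m_eq lM) /= aE bE.
case: (alpha _ _) (beta _ _) => [a||] [b||] //.
rewrite -!EFinD; congr EFin; have h (x y z : int) : x + z - (y + z) = x - y by ring.
exact: h.
Qed.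

End Jump.

Theorem theorem3p3 (R : realType) (X : completeNormedModType R[i])
    (T : {linear X -> X}) :
  ldim [set: X] = +oo%E -> continuous T -> semi_B_Fredholm T [set: X] ->
  exists d : nat, dis T [set: X] = (d%:Z)%:E /\
  exists M N : set X,
    [/\ Red T M N,
        (ldim N < +oo)%E,
        has_jump T M 0%E /\ dis T M = m_ T [set: X],
        nilpotent_of_degree T N d &
        ind T [set: X] = ind T M].
Proof.
move=> _ cT sbf.
have sX : subsp (setT : set X) by split.
have iX : stable T setT by [].
have cX : closed (setT : set X) by exact: closedT.
have [m lm cR] := semi_B_Fredholm_ranges sX iX cX cT sbf.
have [d [dE md st jmp]] := dis_least sX iX lm.
exists d; split => //.
have [M [N [rMN nN stM]]] := reduction_exists cT lm md cR st jmp.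
have [[sM cM iM] [sN iN fN _] MN dec _] := rMN.
have lM : least_fin T M m.
  split; first by apply/(reduction_fin m rMN); case: lm.
  by move=> j /(reduction_fin j rMN); apply: lm.2.
have cRM n : (m <= n)%N -> closed (rg T M n).
  move=> mn; rewrite (_ : rg T M n = M `&` rg T setT n).
    by apply: closedI => //; apply: cR.
  by apply/seteqP; split => x /(reduction_rg _ _ rMN).
exists M, N; split; [|exact: fN| |exact: nN|].
- split.
  + split; split.
    * by rewrite inE; apply: subsp0.
    * by move=> a x y; rewrite !inE; apply: sM.2.
    * by rewrite inE; apply: subsp0.
    * by move=> a x y; rewrite !inE; apply: sN.2.
  + by split => //; apply: findim_closed.
  + by split=> _ [x ? <-]; [apply: iM|apply: iN].
  + apply/seteqP; split=> x; first by case; apply: MN.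
    by move=> ->; split; apply: subsp0.
  + exact: dec.
- split; first exact: (has_jump0 cT sM iM cM lM cRM stM).
  by rewrite (dis_eq sM iM lM stM) (m_eq lm).
- exact: (reduction_ind rMN lm lM).
Qed.
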